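(* Let $G$ be a Cohen–Macaulay cactus graph and let $J(G)$ be its vertex cover ideal. Then for every integer $k\geq 1$, the ideal $J(G)^k$ is weakly polymatroidal, i.e. there is a total ordering $x_1>x_2>\cdots>x_n$ of the variables of $S$ such that $J(G)^k$ is weakly polymatroidal with respect to this ordering.
   Context: Let $G$ be a finite simple graph with vertex set $V(G)=\{x_1,\dots,x_n\}$, and let $S=K[x_1,\dots,x_n]$ be the polynomial ring over a field $K$, identifying vertices with variables. A vertex cover of $G$ is a subset $C\subseteq V(G)$ meeting every edge; it is minimal if no proper subset is a vertex cover. The vertex cover ideal is $J(G)=\big(\prod_{x\in C}x : C \text{ a minimal vertex cover of } G\big)\subseteq S$. The edge ideal is $I(G)=(x_ix_j:\{x_i,x_j\}\in E(G))$, and $G$ is Cohen–Macaulay if $S/I(G)$ is a Cohen–Macaulay ring. A cactus graph is a connected graph in which each edge belongs to at most one cycle. A monomial ideal $I$ generated in a single degree is weakly polymatroidal with respect to the ordering $x_1>\cdots>x_n$ if for any two minimal monomial generators $u=x_1^{a_1}\cdots x_n^{a_n}$ and $v=x_1^{b_1}\cdots x_n^{b_n}$ of $I$ such that there is an index $t$ with $a_1=b_1,\dots,a_{t-1}=b_{t-1}$ and $a_t>b_t$, there exists $j>t$ such that $x_t v/x_j\in I$. *)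

(* Defs.v *)
From HB Require Import structures.
From mathcomp Require Import all_boot all_order all_algebra.
From mathcomp Require Import all_fingroup.
From mathcomp Require Import mpoly.
Set Implicit Arguments. Unset Strict Implicit. Unset Printing Implicit Defensive.
Import Order.TTheory GRing.Theory.
Local Open Scope ring_scope.

Section Defs.
Variables (K : fieldType) (n : nat).
Local Notation S := {mpoly K[n]}.

Definition pset := S -> Prop.

Definition ideal_gen (A : pset) : pset := fun f =>
  exists cs : seq (S * S), (forall p, p \in cs -> A p.2) /\
                           f = \sum_(p <- cs) p.1 * p.2.

Definition is_ideal (P : pset) : Prop :=
  [/\ P 0, (forall a b, P a -> P b -> P (a + b)) & (forall r a, P a -> P (r * a))].

Definition is_prime_ideal (P : pset) : Prop :=
  [/\ is_ideal P, ~ P 1 & forall a b, P (a * b) -> P a \/ P b].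

Definition ideal_mul (I J : pset) : pset := fun f =>
  exists cs : seq (S * S), (forall p, p \in cs -> I p.1 /\ J p.2) /\
                           f = \sum_(p <- cs) p.1 * p.2.

Definition ideal_pow (I : pset) (k : nat) : pset := iter k (ideal_mul I) (fun _ => True).

Definition max_ideal : pset := ideal_gen (fun p => exists i : 'I_n, p = 'X_i).

(* there is a chain of prime ideals P_0 < P_1 < ... < P_d of S all containing I,
   i.e. a chain of primes of length d in S/I *)
Definition prime_chain (I : pset) (d : nat) : Prop :=
  exists P : nat -> pset,
    (forall i, (i <= d)%N -> is_prime_ideal (P i) /\ (forall f, I f -> P i f)) /\
    (forall i, (i < d)%N -> (forall f, P i f -> P i.+1 f) /\ exists f, P i.+1 f /\ ~ P i f).

Definition ideal_add_seq (I : pset) (f : nat -> S) (i : nat) : pset :=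
  ideal_gen (fun p => I p \/ exists j, (j < i)%N /\ p = f j).

Definition regular_seq (I : pset) (d : nat) : Prop :=
  exists f : nat -> S,
    (forall i, (i < d)%N -> max_ideal (f i)) /\
    (forall i, (i < d)%N -> forall g,
        ideal_add_seq I f i (g * f i) -> ideal_add_seq I f i g) /\
    ~ ideal_add_seq I f d 1.

(* S/I is Cohen-Macaulay (graded sense): depth_m(S/I) = dim(S/I).  Since the
   sets of achievable regular-sequence lengths and prime-chain lengths are
   both downward closed, equality of their suprema is equality of the sets. *)
Definition cohen_macaulay (I : pset) : Prop :=
  forall d, prime_chain I d <-> regular_seq I d.

Definition simple_graph (e : rel 'I_n) : Prop := irreflexive e /\ ssrbool.symmetric e.

Definition connected_graph (e : rel 'I_n) : Prop := forall x y, connect e x y.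

Definition is_cycle (e : rel 'I_n) (c : seq 'I_n) : Prop :=
  [/\ (3 <= size c)%N, uniq c & path.cycle e c].

Definition cycle_edges (c : seq 'I_n) : {set {set 'I_n}} :=
  [set [set x; next c x] | x in c].

Definition cactus (e : rel 'I_n) : Prop :=
  connected_graph e /\
  forall c1 c2 x y, is_cycle e c1 -> is_cycle e c2 -> e x y ->
    [set x; y] \in cycle_edges c1 -> [set x; y] \in cycle_edges c2 ->
    cycle_edges c1 = cycle_edges c2.

Definition edge_ideal (e : rel 'I_n) : pset :=
  ideal_gen (fun p => exists i j : 'I_n, e i j /\ p = 'X_i * 'X_j).

Definition vertex_cover (e : rel 'I_n) (C : {set 'I_n}) : Prop :=
  forall x y, e x y -> x \in C \/ y \in C.

Definition minimal_vertex_cover (e : rel 'I_n) (C : {set 'I_n}) : Prop :=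
  vertex_cover e C /\ forall D : {set 'I_n}, D \proper C -> ~ vertex_cover e D.

Definition cover_ideal (e : rel 'I_n) : pset :=
  ideal_gen (fun p => exists C, minimal_vertex_cover e C /\ p = \prod_(i in C) 'X_i).

Definition min_mon_gen (I : pset) (m : 'X_{1..n}) : Prop :=
  I 'X_[m] /\ forall m', I 'X_[m'] -> (m' <= m)%MM -> m' = m.

(* the ordering is x_{s 0} > x_{s 1} > ... > x_{s (n-1)} *)
Definition weakly_polymatroidal_wrt (s : 'S_n) (I : pset) : Prop :=
  (forall u v, min_mon_gen I u -> min_mon_gen I v -> mdeg u = mdeg v) /\
  forall u v (t : 'I_n), min_mon_gen I u -> min_mon_gen I v ->
    (forall r : 'I_n, (r < t)%N -> u (s r) = v (s r)) ->
    (v (s t) < u (s t))%N ->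
    exists j : 'I_n, (t < j)%N /\
      exists w : 'X_{1..n}, (w + U_(s j) = v + U_(s t))%MM /\ I 'X_[w].

Definition weakly_polymatroidal (I : pset) : Prop :=
  exists s : 'S_n, weakly_polymatroidal_wrt s I.

End Defs.

(* Main.v *)
Require Import Defs.
From mathcomp Require Import all_boot all_order all_algebra.
From mathcomp Require Import all_fingroup.
From mathcomp Require Import mpoly.
From mathcomp Require Import ring zify.
Set Implicit Arguments. Unset Strict Implicit. Unset Printing Implicit Defensive.
Import GRing.Theory.

(** A regular sequence of length [d] on [S/I] inside the maximal ideal kills the Koszul cohomology
of [S/I] in degrees below [d], for every sequence generating an ideal with radical the maximal
ideal.  Explicit cocycles then show that a Cohen-Macaulay graph is well-covered (all its maximal
independent sets have the same size) and is neither a 4-cycle nor a 7-cycle.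

In a well-covered connected cactus other than these two cycles, every vertex lies in a clique
[N[y]] with [y] simplicial, or in a basic 5-cycle [p1 p2 p3 p4 p5] (where [p2], [p4], [p5] have
degree 2), or in an edge [ab] of a 4-cycle [abcd] with [a], [b] of degree 2: a vertex of degree at
least 3 is handled by exchanging the two sides of a maximal independent set at a cut vertex, and a
vertex of degree 2 by replacing its neighbours by simplicial or free vertices of their blocks.

A generator of [J(G)^k] is a product of [k] complements of maximal independent sets.  Order the
vertices so that [p2] and the simplicial vertices come last, preceded by [p4], [p5] and the
vertices [a], [b], preceded by all others.  The number of elements of a maximal independent set in
each clique, 5-cycle or edge as above is constant, so the required exchange can be made within one
block; the only exchange that moves a vertex [p3] with outside neighbours also swaps, between two
of the [k] sets, everything hanging at [p3], which is possible because [p3] separates it from the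
rest of the cactus. *)

(** * Koszul cohomology and regular sequences *)

Section Koszul.
Local Open Scope ring_scope.
Variables (R : comNzRingType) (I : finType).
Implicit Types (y : I -> R) (z w : seq I -> R) (s t : seq I) (J : R -> Prop).

Definition ideal J :=
  [/\ J 0, (forall a b, J a -> J b -> J (a + b)) & (forall r a, J a -> J (r * a))].

Lemma ideal_opp J a : ideal J -> J a -> J (- a).
Proof. by move=> [_ _ Jm] Ja; rewrite -mulN1r; apply: Jm. Qed.

Lemma ideal_sub J a b : ideal J -> J a -> J b -> J (a - b).
Proof. by move=> JJ Ja Jb; have [_ Jd _] := JJ; apply: Jd => //; apply: ideal_opp. Qed.

Lemma ideal_sum J (T : eqType) (r : seq T) (F : T -> R) :
  ideal J -> (forall i, i \in r -> J (F i)) -> J (\sum_(i <- r) F i).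
Proof.
move=> [J0 Jd _] JF; rewrite big_seq.
by elim/big_ind: _ => // i; apply: JF.
Qed.

Lemma ideal_mod J a b : ideal J -> J (a - b) -> J b -> J a.
Proof. by move=> [_ Jd _] Jab Jb; rewrite -[a](subrK b); apply: Jd. Qed.

Lemma ideal_radical_add J a b m k :
  ideal J -> J (a ^+ m) -> J (b ^+ k) -> J ((a + b) ^+ (m + k)).
Proof.
move=> JJ Ja Jb; rewrite exprDn; apply: ideal_sum => // i _.
have [_ _ Jm] := JJ; rewrite -mulr_natl; apply: (Jm).
have [le_ki|lt_ik] := leqP k i.
  by rewrite -{2}(subnK le_ki) exprD mulrA; apply: (Jm).
have -> : (m + k - i)%N = ((k - i) + m)%N by rewrite -addnBA 1?addnC ?(ltnW lt_ik).
by rewrite exprD mulrAC; apply: Jm.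
Qed.

Lemma ideal_radical_sum J (T : eqType) (r : seq T) (F : T -> R) :
  ideal J -> (forall i, i \in r -> exists m, J (F i ^+ m)) ->
  exists m, J ((\sum_(i <- r) F i) ^+ m).
Proof.
move=> JJ; elim: r => [|i r IHr] JF.
  by exists 1%N; rewrite big_nil expr1; case: JJ.
have [m Jm] := JF i (mem_head _ _).
have [k Jk] : exists k, J ((\sum_(i <- r) F i) ^+ k).
  by apply: IHr => j jr; apply: JF; rewrite inE jr orbT.
by exists (m + k)%N; rewrite big_cons; apply: ideal_radical_add.
Qed.

(* Koszul cochains on arbitrary (not necessarily alternating) words. *)
Fixpoint koszul y z s : R :=
  if s is i :: s' then y i * z s' - koszul y (fun t => z (i :: t)) s' else 0.

Lemma eq_koszul y z w s : z =1 w -> koszul y z s = koszul y w s.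
Proof.
elim: s z w => //= i s IHs z w eq_zw.
by rewrite eq_zw; congr (_ - _); apply: IHs => t; apply: eq_zw.
Qed.

Lemma koszul_linear y c z w s :
  koszul y (fun t => c * z t + w t) s = c * koszul y z s + koszul y w s.
Proof.
elim: s z w => [|i s IHs] z w /=; first by rewrite mulr0 addr0.
rewrite IHs; ring.
Qed.

Lemma koszulB y z w s :
  koszul y (fun t => z t - w t) s = koszul y z s - koszul y w s.
Proof.
rewrite (@eq_koszul _ _ (fun t => -1 * w t + z t)); last by move=> t; ring.
rewrite koszul_linear; ring.
Qed.

Lemma koszulZ y c z s : koszul y (fun t => c * z t) s = c * koszul y z s.
Proof.
elim: s z => [|i s IHs] z /=; first by rewrite mulr0.
rewrite IHs; ring.
Qed.

Lemma koszul_sum y (T : Type) (r : seq T) (F : T -> seq I -> R) s :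
  koszul y (fun t => \sum_(j <- r) F j t) s = \sum_(j <- r) koszul y (F j) s.
Proof.
elim: s F => [|i s IHs] F /=; first by rewrite big1.
by rewrite IHs mulr_sumr sumrB.
Qed.

Lemma koszul_linearl y y' c z s :
  koszul (fun i => c * y i + y' i) z s = c * koszul y z s + koszul y' z s.
Proof.
elim: s z => [|i s IHs] z /=; first by rewrite mulr0 addr0.
rewrite IHs; ring.
Qed.

Lemma koszul_koszul y z s : koszul y (koszul y z) s = 0.
Proof.
elim: s z => //= i s IHs z.
rewrite koszulB koszulZ IHs; ring.
Qed.

(** Polarisation of [koszul_koszul]: the differential for [y + y'] also has square zero, and the
    differential is linear in the sequence. *)
Lemma koszul_anticomm y y' z s :
  koszul y (koszul y' z) s = - koszul y' (koszul y z) s.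
Proof.
have := koszul_koszul (fun i => 1 * y i + y' i) z s.
rewrite (@eq_koszul _ _ (fun t => 1 * koszul y z t + koszul y' z t)); last first.
  by move=> t; rewrite koszul_linearl.
rewrite koszul_linear !koszul_linearl !koszul_koszul => H.
by apply/eqP; rewrite -addr_eq0 -H; apply/eqP; ring.
Qed.

Lemma koszul_ideal J y z s : ideal J ->
  (forall t, (size t).+1 = size s -> J (z t)) -> J (koszul y z s).
Proof.
move=> JJ; elim: s z => [|i s IHs] z Jz /=; first by case: JJ.
apply: ideal_sub => //; first by case: JJ => _ _; apply; apply: Jz.
by apply: IHs => t st; apply: Jz; rewrite /= st.
Qed.

Lemma koszul_ideall J y z s : ideal J ->
  (forall i t, i \in s -> J (y i * z t)) -> J (koszul y z s).
Proof.
move=> JJ; elim: s z => [|i s IHs] z Jz /=; first by case: JJ.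
apply: ideal_sub => //; first by apply: Jz; rewrite mem_head.
by apply: IHs => j t js; apply: Jz; rewrite inE js orbT.
Qed.

(** Cartan's formula: contraction with [a] is a homotopy between zero and multiplication by the
    combination of the [y i] with coefficients [a i]. *)
Lemma koszul_homotopy y (a : I -> R) z s :
  \sum_i a i * koszul y z (i :: s) =
  (\sum_i a i * y i) * z s - koszul y (fun t => \sum_i a i * z (i :: t)) s.
Proof.
rewrite koszul_sum mulr_suml -sumrB; apply: eq_bigr => i _ /=.
rewrite koszulZ; ring.
Qed.

(** Vanishing of the degree [k] cohomology modulo [J]. A coboundary is 0 on the empty word, so in
    degree 0 the conclusion says that [z [::]] lies in [J]. *)
Definition koszul_exact J y k := forall z,
  (forall s, size s = k.+1 -> J (koszul y z s)) ->
  exists w, forall s, size s = k -> J (z s - koszul y w s).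

(* Multiplication by an element of the radical of [(y)] is nilpotent on cohomology; the powers of
   [f] are then divided out one at a time. *)
Lemma koszul_exactS J J' y f k m (a : I -> R) : ideal J -> ideal J' ->
  (forall g, J g -> J' g) ->
  (forall g, J' g -> exists h, J (g - f * h)) ->
  (forall g, J (g * f) -> J g) ->
  J' f ->
  f ^+ m = \sum_i a i * y i ->
  koszul_exact J' y k -> koszul_exact J y k.+1.
Proof.
move=> JJ JJ' sJJ' J'P regf J'f fm exJ' z zcoc.
have [J0 Jd Jm] := JJ.
(* By the homotopy formula, [f ^+ m * z] is a coboundary modulo [J]. *)
have: exists h, forall s, size s = k.+1 -> J (f ^+ m * z s - koszul y h s).
  exists (fun t => \sum_i a i * z (i :: t)) => s ss.
  rewrite fm -koszul_homotopy; apply: ideal_sum => // i _.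
  by apply: Jm; apply: zcoc; rewrite /= ss.
elim: m {a fm} => [|m IHm] [h hP].
  by exists h => s ss; rewrite -[z s]mul1r -(expr0 f); apply: hP.
(* Lowering the exponent: [f] lies in [J'], so [h] is a cocycle modulo [J']. Writing [h] as
   [koszul y g + f * w] modulo [J] and applying the differential, [f ^+ m.+1 * z] equals
   [f * koszul y w] modulo [J], and one factor [f] cancels. *)
apply: IHm.
have [_ J'd J'm] := JJ'.
have hcoc s : size s = k.+1 -> J' (koszul y h s).
  move=> ss; apply: (@ideal_mod _ _ (f ^+ m.+1 * z s)) => //.
    by rewrite -opprB; apply: ideal_opp => //; apply/sJJ'/hP.
  by rewrite exprSr mulrAC; apply: J'm.
have [g gP] := exJ' h hcoc.
have /fin_all_exists [q qP] : forall t : k.-tuple I, exists q,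
    J (h t - koszul y g t - f * q).
  by move=> t; apply: J'P; apply: gP; rewrite size_tuple.
pose w t := if insub t is Some t' then q t' else 0.
have wP t : size t = k -> J (h t - koszul y g t - f * w t).
  by move=> /eqP st; rewrite /w insubT; apply: (qP (Tuple st)).
exists w => s ss; apply: regf.
have := @koszul_ideal _ y (fun t => h t - koszul y g t - f * w t) s JJ.
rewrite !koszulB koszul_koszul koszulZ subr0 ss => kP.
have {}kP : J (koszul y h s - f * koszul y w s).
  by apply: kP => t [st]; apply: wP.
have := Jd _ _ (hP s ss) kP; rewrite exprS.
by congr J; ring.
Qed.

End Koszul.

(** * Exterior products of dual basis forms *)

Section Wedge.
Local Open Scope ring_scope.
Variables (R : comNzRingType) (I : finType).
Implicit Types (y : I -> R) (z : seq I -> R) (s t F : seq I) (J : R -> Prop).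

Definition comb y (g : R) := exists a : I -> R, g = \sum_i a i * y i.

Lemma ideal_comb y : ideal (comb y).
Proof.
split; first by exists (fun=> 0); rewrite big1 // => i _; rewrite mul0r.
  move=> _ _ [a ->] [b ->]; exists (fun i => a i + b i).
  by rewrite -big_split; apply: eq_bigr => i _; rewrite mulrDl.
move=> r _ [a ->]; exists (fun i => r * a i).
by rewrite mulr_sumr; apply: eq_bigr => i _; rewrite mulrA.
Qed.

Lemma comb_gen y i : comb y (y i).
Proof.
exists (fun j => (j == i)%:R); rewrite (bigD1 i) //= eqxx mul1r big1 ?addr0 //.
by move=> j /negPf ->; rewrite mul0r.
Qed.

Definition zero_ideal (g : R) := g = 0.

Lemma ideal0 : ideal zero_ideal.
Proof.
by split=> // [_ _ -> ->|r _ ->]; rewrite /zero_ideal ?addr0 ?mulr0.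
Qed.

Definition dual_form (a i : I) : R := (i == a)%:R.

(** [c] times the exterior product of the dual basis forms of [F]; multiplication by a form is its
    Koszul differential. *)
Fixpoint wedge F (c : R) : seq I -> R :=
  if F is a :: F' then koszul (dual_form a) (wedge F' c)
  else fun s => if s is [::] then c else 0.

Lemma wedgeE F c s : wedge F c s = c * wedge F 1 s.
Proof.
elim: F s => [|a F IHF] s /=; first by case: s => [|? ?]; rewrite ?mulr1 ?mulr0.
by rewrite -koszulZ; apply: eq_koszul.
Qed.

Lemma koszul_wedge b F c s : b \in F -> koszul (dual_form b) (wedge F c) s = 0.
Proof.
elim: F s => //= a F IHF s; rewrite inE.
have [-> _|_ /= bF] := eqVneq b a; first by rewrite koszul_koszul.
rewrite koszul_anticomm; apply/eqP; rewrite oppr_eq0; apply/eqP.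
by apply: (koszul_ideal _ ideal0) => t _; apply: IHF.
Qed.

Lemma wedge_id F c : uniq F -> wedge F c F = c.
Proof.
elim: F => //= a F IHF /andP[aF uF].
rewrite /dual_form eqxx mul1r IHF // [X in _ - X](_ : _ = 0) ?subr0 //.
apply: (koszul_ideall ideal0) => i t iF.
by rewrite (_ : i == a = false) ?/zero_ideal ?mul0r //; apply: contraNF aF => /eqP <-.
Qed.

Lemma eq_koszull y y' z s : y =1 y' -> koszul y z s = koszul y' z s.
Proof. by move=> eq_y; elim: s z => //= i s IHs z; rewrite eq_y IHs. Qed.

Lemma koszul_suml (r : seq I) (c : I -> R) (Y : I -> I -> R) z s :
  koszul (fun i => \sum_(a <- r) c a * Y a i) z s =
  \sum_(a <- r) c a * koszul (Y a) z s.
Proof.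
elim: r => [|a r IHr].
  rewrite big_nil; apply: (koszul_ideall ideal0) => i t _.
  by rewrite big_nil mul0r.
rewrite big_cons -IHr -koszul_linearl; apply: eq_koszull => i.
by rewrite big_cons.
Qed.

(** The part of [y] supported on [F] is killed by [koszul_wedge], and the remaining coefficients
    multiply [c] into [J]. *)
Lemma koszul_wedge_cocycle J y F c s : ideal J -> uniq F ->
  (forall i, i \notin F -> J (y i * c)) -> J (koszul y (wedge F c) s).
Proof.
move=> JJ uF Jy.
pose y' i := if i \in F then 0 else y i.
have -> : koszul y (wedge F c) s = koszul y' (wedge F c) s.
  transitivity (koszul (fun i => 1 * (\sum_(a <- F) y a * dual_form a i) + y' i)
     (wedge F c) s).
    apply: eq_koszull => i; rewrite mul1r /y'; case: ifPn => iF.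
      rewrite (bigD1_seq i) //= big1 /dual_form ?eqxx ?mulr1 ?addr0 //.
      by move=> a /negPf; rewrite eq_sym => ->; rewrite mulr0.
    rewrite big_seq big1 ?add0r // => a aF.
    rewrite /dual_form (_ : i == a = false) ?mulr0 //.
    by apply: contraNF iF => /eqP ->.
  rewrite koszul_linearl koszul_suml big_seq big1 ?mulr0 ?add0r // => a aF.
  by rewrite koszul_wedge // mulr0.
have [J0 _ Jm] := JJ.
apply: koszul_ideall => // i t _; rewrite /y'.
case: ifPn => iF; first by rewrite mul0r.
by rewrite wedgeE mulrA mulrC; apply: Jm; apply: Jy.
Qed.

End Wedge.

(** * Regular sequences and vanishing of Koszul cohomology *)

Section RegularSequence.
Local Open Scope ring_scope.
Variables (K : fieldType) (n : nat).
Local Notation S := {mpoly K[n]}.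
Implicit Types (I J A : @pset K n).

Lemma ideal_gen_ideal A : ideal (ideal_gen A).
Proof.
split; first by exists [::]; split=> //; rewrite big_nil.
  move=> _ _ [c1 [A1 ->]] [c2 [A2 ->]]; exists (c1 ++ c2); split.
    by move=> p; rewrite mem_cat => /orP[]; [apply: A1|apply: A2].
  by rewrite big_cat.
move=> r _ [c [Ac ->]]; exists [seq (r * p.1, p.2) | p <- c]; split.
  by move=> p /mapP[q qc ->] /=; apply: Ac.
by rewrite mulr_sumr big_map; apply: eq_bigr => p _; rewrite mulrA.
Qed.

Lemma ideal_gen_sub A g : A g -> ideal_gen A g.
Proof.
move=> Ag; exists [:: (1, g)]; split; last by rewrite big_seq1 /= mul1r.
by move=> p; rewrite inE => /eqP ->.
Qed.

Lemma ideal_gen_min A J g : ideal J -> (forall p, A p -> J p) ->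
  ideal_gen A g -> J g.
Proof.
move=> JJ AJ [c [Ac ->]]; apply: ideal_sum => // p pc.
by case: JJ => _ _; apply; apply/AJ/Ac.
Qed.

Lemma ideal_add_seqS I f i g :
  ideal_add_seq I f i.+1 g -> exists h, ideal_add_seq I f i (g - f i * h).
Proof.
pose Q g := exists h, ideal_add_seq I f i (g - f i * h).
have idJ := ideal_gen_ideal (fun p => I p \/ exists j, (j < i)%N /\ p = f j).
have [J0 Jd Jm] := idJ.
apply: (@ideal_gen_min _ Q).
  split; first by exists 0; rewrite mulr0 subr0.
    move=> a b [h ha] [h' hb]; exists (h + h').
    by have := Jd _ _ ha hb; congr (ideal_add_seq _ _ _ _); ring.
  move=> r a [h ha]; exists (r * h).
  by have := Jm r _ ha; congr (ideal_add_seq _ _ _ _); ring.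
move=> p [Ip|[j [le_ji ->]]].
  by exists 0; rewrite mulr0 subr0; apply: ideal_gen_sub; left.
move: le_ji; rewrite ltnS leq_eqVlt => /orP[/eqP ->|lt_ji].
  by exists 1; rewrite mulr1 subrr.
by exists 0; rewrite mulr0 subr0; apply: ideal_gen_sub; right; exists j.
Qed.

Lemma ideal_add_seq0 I f g : ideal I -> ideal_add_seq I f 0 g -> I g.
Proof. by move=> II; apply: ideal_gen_min => // p [//|[j [//]]]. Qed.

Lemma max_idealP g : max_ideal g -> comb (fun i : 'I_n => 'X_i : S) g.
Proof.
apply: ideal_gen_min; first exact: ideal_comb.
by move=> _ [i ->]; apply: comb_gen.
Qed.

(** Induction on the degree with [koszul_exactS]: vanishing in degree [k] after adjoining one more
    element of the sequence gives vanishing in degree [k.+1]. A power of each [f i] lies in the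
    ideal of the [y], because a power of every variable does. *)
Lemma regular_seq_koszul_exact I d (y : 'I_n -> S) k : ideal I ->
  (forall i, exists m, comb y ('X_i ^+ m)) ->
  regular_seq I d -> (k < d)%N -> koszul_exact I y k.
Proof.
move=> II radX [f [fmax [freg _]]] lt_kd.
have frad i : (i < d)%N -> exists m, comb y (f i ^+ m).
  move=> lt_id; have [a ->] := max_idealP (fmax i lt_id).
  apply: ideal_radical_sum => [|j _]; first exact: ideal_comb.
  have [m ym] := radX j; exists m; rewrite exprMn.
  by have [_ _] := ideal_comb y; apply.
suff: koszul_exact (ideal_add_seq I f 0) y k.
  move=> ex z zcoc; have [|w wP] := ex z.
    by move=> s ss; apply: ideal_gen_sub; left; apply: zcoc.
  by exists w => s ss; apply: ideal_add_seq0 II _; apply: wP.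
(* Generalised to initial segments of length [i]. Degree 0 still uses one regular element, hence the
   bound [i + k < d]. *)
have: (0 + k < d)%N by [].
elim: k 0%N {lt_kd} => [|k IHk] i ltd.
  move=> z zcoc; exists (fun=> 0) => s ss.
  have idJ := ideal_gen_ideal (fun p => I p \/ exists j, (j < i)%N /\ p = f j).
  rewrite addn0 in ltd.
  have [m [a fm]] := frad i ltd.
  rewrite (size0nil ss) /= subr0.
  have: ideal_add_seq I f i (f i ^+ m * z [::]).
    rewrite fm mulr_suml; apply: ideal_sum => // j _.
    have [_ _ Jm] := idJ; rewrite -mulrA; apply: Jm.
    by have := zcoc [:: j] erefl; rewrite /= subr0.
  elim: m {fm} => [|m IHm]; first by rewrite expr0 mul1r.
  by rewrite exprSr mulrAC => /(freg _ ltd).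
have lti : (i < d)%N by apply: leq_ltn_trans ltd; rewrite leq_addr.
have [m [a fm]] := frad i lti.
apply: (@koszul_exactS _ _ _ (ideal_add_seq I f i.+1) _ (f i) k m a) => //.
- exact: ideal_gen_ideal.
- exact: ideal_gen_ideal.
- move=> g; apply: ideal_gen_min; first exact: ideal_gen_ideal.
  move=> p [Ip|[j [ltji ->]]]; apply: ideal_gen_sub; first by left.
  by right; exists j; split=> //; apply: ltnW.
- exact: ideal_add_seqS.
- exact: freg.
- by apply: ideal_gen_sub; right; exists i.
by apply: IHk; rewrite addSn -addnS.
Qed.

Lemma mcoeff_monomial_ideal A (m0 : 'X_{1..n}) g :
  (forall p, A p -> exists2 m, p = 'X_[m] & ~~ (m <= m0)%MM) ->
  ideal_gen A g -> g@_m0 = 0.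
Proof.
move=> Am [c [Ac ->]]; rewrite raddf_sum /= big_seq big1 // => p /Ac /Am [m -> mm0].
apply/memN_msupp_eq0; rewrite (perm_mem (msuppMX _ _)).
by apply: contra mm0 => /mapP[m' _ ->]; rewrite lem_addr.
Qed.

End RegularSequence.

Definition indep (T : finType) (e : rel T) (F : {set T}) :=
  [forall x in F, forall y in F, ~~ e x y].

Lemma indepP (T : finType) (e : rel T) (F : {set T}) :
  reflect (forall x y, x \in F -> y \in F -> e x y = false) (indep e F).
Proof.
apply: (iffP forall_inP) => [H x y xF yF|H x xF].
  by apply/negbTE; move/forall_inP: (H x xF); apply.
by apply/forall_inP => y yF; rewrite H.
Qed.

(** * Consequences of the Cohen-Macaulay property *)

Section CohenMacaulay.
Local Open Scope ring_scope.
Variables (K : fieldType) (n : nat) (e : rel 'I_n).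
Local Notation S := {mpoly K[n]}.
Local Notation EI := (@edge_ideal K n e).

(** The substitution with this tuple has as kernel the prime ideal generated by the variables
    outside [L]. *)
Definition keep_vars (L : seq 'I_n) : n.-tuple S :=
  [tuple if i \in L then 'X_i else 0 | i < n].

Lemma keep_varsX L i : 'X_i \mPo keep_vars L = if i \in L then 'X_i else 0.
Proof. by rewrite comp_mpolyXU -tnth_nth tnth_mktuple. Qed.

Lemma keep_vars_comp L L' (g : S) : {subset L' <= L} ->
  (g \mPo keep_vars L) \mPo keep_vars L' = g \mPo keep_vars L'.
Proof.
move=> sL; rewrite [g \mPo keep_vars L]comp_mpolyEX [RHS]comp_mpolyEX.
rewrite raddf_sum; apply: eq_bigr => m _ /=; rewrite comp_mpolyZ; congr (_ *: _).
rewrite !comp_mpolyX rmorph_prod; apply: eq_bigr => i _ /=.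
rewrite rmorphXn /= !tnth_mktuple; case: ifP => iL; first by rewrite keep_varsX.
case: ifP => iL' //; last by rewrite comp_mpoly0.
by move: (sL _ iL'); rewrite iL.
Qed.

(** The primes are the kernels of [keep_vars] for the successive tails of [F]. Every edge has an
    endpoint outside [F], so each of them contains the edge ideal. *)
Lemma edge_ideal_prime_chain (F : {set 'I_n}) d :
  indep e F -> (d <= #|F|)%N -> prime_chain EI d.
Proof.
move=> /indepP iF le_dF.
pose L i := drop i (enum F).
exists (fun i g => g \mPo keep_vars (L i) = 0); split=> [i le_id|i lt_id].
  split; first split.
  - split=> [|a b a0 b0|r a a0]; first exact: comp_mpoly0.
      by rewrite comp_mpolyD a0 b0 addr0.
    by rewrite rmorphM /= a0 mulr0.
  - by rewrite comp_mpoly1 => /eqP; rewrite oner_eq0.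
  - move=> a b /eqP; rewrite rmorphM /= mulf_eq0.
    by case/orP=> /eqP ->; [left|right].
  move=> f; pose J (g : S) := g \mPo keep_vars (L i) = 0.
  apply: (@ideal_gen_min _ _ _ J).
    rewrite /J; split=> [|a b a0 b0|r a a0]; first exact: comp_mpoly0.
      by rewrite comp_mpolyD a0 b0 addr0.
    by rewrite rmorphM /= a0 mulr0.
  move=> _ [x [y [exy ->]]]; rewrite /J rmorphM /= !keep_varsX.
  case: ifP => xL; last by rewrite mul0r.
  case: ifP => yL; last by rewrite mulr0.
  by move: exy; rewrite iF // -mem_enum; apply: (mem_drop (n0 := i)).
have lt_i : (i < size (enum F))%N by rewrite -cardE (leq_trans lt_id).
have [x0 _] : exists x0, x0 \in F by apply/card_gt0P; apply: leq_ltn_trans (leq0n _) (leq_trans lt_id le_dF).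
have dropE : L i = nth x0 (enum F) i :: L i.+1 by rewrite /L (drop_nth x0).
split.
  move=> f f0; rewrite -(@keep_vars_comp (L i) (L i.+1)) ?f0 ?comp_mpoly0 //.
  by move=> x xL; rewrite dropE inE xL orbT.
exists 'X_(nth x0 (enum F) i); rewrite !keep_varsX dropE mem_head.
have : uniq (L i) by rewrite drop_uniq ?enum_uniq.
rewrite dropE /= => /andP[/negPf -> _]; split=> //.
by move/eqP; rewrite -msupp_eq0 msuppX.
Qed.

Hypothesis eirr : irreflexive e.
Hypothesis e_sym : ssrbool.symmetric e.
Hypothesis CM : cohen_macaulay EI.

Lemma edge_ideal_gen i j (r : S) : e i j -> EI (r * ('X_i * 'X_j)).
Proof.
move=> eij; have [_ _] := ideal_gen_ideal (fun p : S =>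
  exists i j : 'I_n, e i j /\ p = 'X_i * 'X_j); apply.
by apply: ideal_gen_sub; exists i, j.
Qed.

(** The Cohen-Macaulay property turns the prime chain of length [#|F|] into a regular sequence of
    that length. *)
Lemma cm_koszul_exact F (y : 'I_n -> S) k :
  (forall i : 'I_n, exists m, comb y ('X_i ^+ m : S)) ->
  indep e F -> (k < #|F|)%N -> koszul_exact EI y k.
Proof.
move=> radX iF ltk; apply: regular_seq_koszul_exact radX _ ltk.
  exact: ideal_gen_ideal.
by apply/CM; apply: edge_ideal_prime_chain iF _.
Qed.

Lemma comb_vars i : exists m, comb (fun i : 'I_n => 'X_i : S) ('X_i ^+ m).
Proof. by exists 1%N; apply: (comb_gen (fun i : 'I_n => 'X_i : S)). Qed.

Lemma edge_ideal_coef (m0 : 'X_{1..n}) g :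
  (forall i j, e i j -> ~~ (U_(i) + U_(j) <= m0)%MM) -> EI g -> g@_m0 = 0.
Proof.
move=> H; apply: mcoeff_monomial_ideal => _ [i [j [eij ->]]].
by exists (U_(i) + U_(j))%MM; [rewrite mpolyXD|apply: H].
Qed.

(* A facet [F] of the independence complex gives the class of [x_F] in the cohomology in
   degree [#|F|] of the squares of the variables, i.e. [1 / x_F] in local cohomology. *)
Lemma cm_unmixed F F' : maxset (indep e) F -> indep e F' -> (#|F'| <= #|F|)%N.
Proof.
move=> /maxsetP[/indepP iF maxF] iF'; rewrite leqNgt; apply/negP => ltF.
pose y i : S := 'X_i ^+ 2.
have ex : koszul_exact EI y #|F|.
  apply: cm_koszul_exact iF' ltF => i; exists 2%N; exact: (comb_gen y).
pose mF : 'X_{1..n} := [multinom (i \in F : nat) | i < n].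
pose c : S := 'X_[mF].
have idE : ideal EI by apply: ideal_gen_ideal.
have [|w wP] := ex (wedge (enum F) c).
  (* A vertex [i] outside [F] has a neighbour in [F] by maximality, so [x_i] times [x_F] is already
     in the edge ideal. *)
  move=> s _; apply: koszul_wedge_cocycle; rewrite ?enum_uniq // => i.
  rewrite mem_enum => niF.
  have [j jF eij] : exists2 j, j \in F & e i j.
    apply/exists_inP; apply: contraT; rewrite negb_exists_in => /forall_inP nb.
    suff FE : i |: F = F by move: niF; rewrite -FE setU11.
    apply: maxF; last exact: subsetUr.
    apply/indepP => a b; rewrite !inE => /orP[/eqP ->|aF] /orP[/eqP ->|bF].
    - exact: eirr.
    - exact/negbTE/nb.
    - by rewrite e_sym; apply/negbTE/nb.
    - exact: iF.
  have -> : c = 'X_[mF - U_(j)] * 'X_j.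
    rewrite -mpolyXD submK //; apply/mnm_lepP => a.
    by rewrite mnm1E mnmE; case: eqP => // <-; rewrite jF.
  have -> : y i * ('X_[mF - U_(j)] * 'X_j) =
    ('X_[mF - U_(j)] * 'X_i) * ('X_i * 'X_j) by rewrite /y; ring.
  exact: edge_ideal_gen.
have sF : size (enum F) = #|F| by rewrite cardE.
have := wP _ sF; rewrite wedge_id ?enum_uniq // => Ec.
(* Evaluation at the word [F] puts [x_F] into the ideal generated by edges and squares, which is
   impossible for a squarefree monomial with independent support. *)
pose A (p : S) := (exists i j, e i j /\ p = 'X_i * 'X_j) \/
  (exists i, p = 'X_i ^+ 2).
have Ac : ideal_gen A c.
  have idA := ideal_gen_ideal A; apply: (ideal_mod idA (b := koszul y w (enum F))).
    by apply: ideal_gen_min Ec => // p Ap; apply: ideal_gen_sub; left.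
  apply: koszul_ideall => // i t _; rewrite mulrC; case: idA => _ _; apply.
  by apply: ideal_gen_sub; right; exists i.
have /eqP : c@_mF = 0.
  apply: mcoeff_monomial_ideal Ac => p [[i [j [eij ->]]]|[i ->]].
    exists (U_(i) + U_(j))%MM; first by rewrite mpolyXD.
    apply/negP => /mnm_lepP le_m.
    have := le_m i; have := le_m j; rewrite !mnmDE !mnm1E !mnmE !eqxx.
    case: (boolP (i \in F)) => iF0; last by rewrite leqNgt.
    case: (boolP (j \in F)) => jF0; last by rewrite addn1 ltn0.
    by move: eij; rewrite iF.
  exists (U_(i) + U_(i))%MM; first by rewrite mpolyXD expr2.
  apply/negP => /mnm_lepP /(_ i); rewrite mnmDE mnm1E eqxx mnmE.
  by case: (i \in F).
by rewrite mcoeffX eqxx oner_eq0.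
Qed.

Lemma edge_ideal_coef1 i g : EI g -> g@_U_(i) = 0.
Proof.
apply: edge_ideal_coef => j k ejk; apply: contraL ejk => le_m.
have: (mdeg (U_(j) + U_(k)) <= mdeg U_(i))%N.
  by rewrite !mdegE; apply: leq_sum => l _; apply: (mnm_lepP le_m).
by rewrite mdegD !mdeg1.
Qed.

Lemma edge_ideal_coef2 i j g : i != j -> e i j = false -> EI g -> g@_(U_(i) + U_(j)) = 0.
Proof.
move=> neq_ij nij; apply: edge_ideal_coef => a b; apply: contraL => /mnm_lepP le_m.
have aP : (i == a) || (j == a).
  by have := le_m a; rewrite !mnmDE !mnm1E eqxx; case: (i == a); case: (j == a).
have bP : (i == b) || (j == b).
  by have := le_m b; rewrite !mnmDE !mnm1E eqxx addn1; case: (i == b); case: (j == b).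
by case/orP: aP => /eqP <-; case/orP: bP => /eqP <-; rewrite ?eirr ?nij // e_sym nij.
Qed.

Lemma coefXM i m (g : S) : ('X_i * g)@_(U_(i) + m) = g@_m.
Proof. by rewrite mulrC mcoeffMX. Qed.

(** [b] is a 0-cocycle of the independence complex, so [x_i] with coefficient [b i] is a Koszul
    cocycle of degree 1 for the variables. Its primitive is a single polynomial, whose constant term
    equals every [b i]. *)
Lemma cm_connected F (b : 'I_n -> K) : indep e F -> (1 < #|F|)%N ->
  (forall i j, i != j -> e i j = false -> b i = b j) -> forall i j, b i = b j.
Proof.
move=> iF ltF bP.
have ex := cm_koszul_exact comb_vars iF ltF.
pose z s : S := if s is [:: i] then b i *: 'X_i else 0.
have [|w wP] := ex z.
  case=> [|i [|j [|? ?]]] //= _; rewrite subr0 -!scalerAr.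
  have [<-|nij] := eqVneq i j; first by rewrite subrr; have [] := ideal_gen_ideal (fun p : S => exists i j, e i j /\ p = 'X_i * 'X_j).
  rewrite ['X_j * 'X_i]mulrC -scalerBl; case: (boolP (e i j)) => eij.
    by rewrite -mul_mpolyC; apply: edge_ideal_gen.
  rewrite (bP i j) ?(negbTE eij) // subrr scale0r.
  by have [] := ideal_gen_ideal (fun p : S => exists i j, e i j /\ p = 'X_i * 'X_j).
suff bE i : b i = (w [::])@_0%MM by move=> i j; rewrite !bE.
have := wP [:: i] erefl; rewrite /= subr0 => /edge_ideal_coef1 => /(_ i).
rewrite raddfB /= mcoeffZ mcoeffX eqxx mulr1.
have := coefXM i 0%MM (w [::]); rewrite addm0 => -> /eqP.
by rewrite subr_eq0 => /eqP.
Qed.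

(** [c] is a 1-cocycle of the independence complex; [x_i x_j] with coefficient [c i j] is then a
    Koszul cocycle of degree 2, and a primitive yields the potential [b]. *)
Lemma cm_simply_connected F (c : 'I_n -> 'I_n -> K) : indep e F -> (2 < #|F|)%N ->
  (forall i j k, e i j = false -> e j k = false -> e i k = false ->
     c j k - c i k + c i j = 0) ->
  exists b, forall i j, i != j -> e i j = false -> c i j = b j - b i.
Proof.
move=> iF ltF cP.
have ex := cm_koszul_exact comb_vars iF ltF.
pose z s : S := if s is [:: i; j] then c i j *: ('X_i * 'X_j) else 0.
have E0 : EI 0 by have [] := ideal_gen_ideal (fun p : S => exists i j, e i j /\ p = 'X_i * 'X_j).
have [|w wP] := ex z.
  case=> [|i [|j [|k [|? ?]]]] //= _; rewrite subr0.
  rewrite (_ : _ - _ = (c j k - c i k + c i j) *: ('X_i * ('X_j * 'X_k))); last first.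
    rewrite -!mul_mpolyC mpolyCD mpolyCB; ring.
  have [eij|nij] := boolP (e i j).
    rewrite (_ : _ *: _ = ((c j k - c i k + c i j)%:MP * 'X_k) * ('X_i * 'X_j)).
      exact: edge_ideal_gen.
    rewrite -mul_mpolyC; ring.
  have [ejk|njk] := boolP (e j k).
    by rewrite scalerAl; apply: edge_ideal_gen.
  have [eik|nik] := boolP (e i k).
    rewrite (_ : _ *: _ = ((c j k - c i k + c i j)%:MP * 'X_j) * ('X_i * 'X_k)).
      exact: edge_ideal_gen.
    rewrite -mul_mpolyC; ring.
  by rewrite cP ?(negbTE nij) ?(negbTE njk) ?(negbTE nik) // scale0r.
(* The coefficients of [x_i x_j] are compared with those of the coboundary [x_i w_j - x_j w_i]. *)
exists (fun j => (w [:: j])@_U_(j)) => i j nij eij.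
have := wP [:: i; j] erefl; rewrite /= subr0 => /(edge_ideal_coef2 nij eij).
rewrite !mcoeffB mcoeffZ -mpolyXD mcoeffX eqxx mulr1 coefXM [X in (_ * _)@_X]addmC coefXM.
by move/eqP; rewrite subr_eq0 => /eqP.
Qed.

End CohenMacaulay.

(** * Independent sets *)

Section Graph.
Variables (n : nat) (e : rel 'I_n).
Hypothesis eirr : irreflexive e.
Hypothesis e_sym : ssrbool.symmetric e.
Local Notation V := 'I_n.
Local Notation mis := (maxset (indep e)).
Implicit Types (F P D X : {set V}) (v w x y z : V).

Definition nbrs2 x y z := [forall t, e x t == (t \in [:: y; z])].

Lemma nbrs2E x y z : nbrs2 x y z -> forall t, e x t = (t == y) || (t == z).
Proof. by move=> /forallP H t; rewrite (eqP (H t)) !inE. Qed.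

Lemma nbrs2P x y z : (forall t, e x t = (t == y) || (t == z)) -> nbrs2 x y z.
Proof. by move=> H; apply/forallP => t; rewrite H !inE. Qed.

Lemma nbrs2C x y z : nbrs2 x y z -> nbrs2 x z y.
Proof. by move=> /nbrs2E H; apply: nbrs2P => t; rewrite H orbC. Qed.

Lemma edge_neq x y : e x y -> x != y.
Proof. by apply: contraTneq => ->; rewrite eirr. Qed.

Lemma mis_ext P : indep e P -> exists2 F, mis F & P \subset F.
Proof. by move=> iP; have [F mF PF] := maxset_exists iP; exists F. Qed.

Lemma mis_indep F x y : mis F -> x \in F -> y \in F -> e x y = false.
Proof. by move=> /maxsetP[/indepP iF _]; apply: iF. Qed.

Lemma indepU1 F x : indep e F -> {in F, forall y, e x y = false} -> indep e (x |: F).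
Proof.
move=> /indepP iF xF; apply/indepP => a b; rewrite !inE.
case/orP=> [/eqP ->|aF] /orP[/eqP ->|bF].
- exact: eirr.
- exact: xF.
- by rewrite e_sym xF.
- exact: iF.
Qed.

Lemma indepS F F' : F' \subset F -> indep e F -> indep e F'.
Proof.
by move=> /subsetP sF /indepP iF; apply/indepP => a b /sF aF /sF bF; apply: iF.
Qed.

Lemma indep1 x : indep e [set x].
Proof. by apply/indepP => a b /set1P -> /set1P ->. Qed.

Lemma indep2 x y : e x y = false -> indep e [set x; y].
Proof.
move=> nxy; apply: indepU1 (indep1 y) _ => z /set1P ->; exact: nxy.
Qed.

Lemma mis_dom F x : mis F -> x \notin F -> exists2 y, y \in F & e x y.
Proof.
move=> /maxsetP[iF maxF] xF; apply/exists_inP; apply: contraT.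
rewrite negb_exists_in => /forall_inP nx.
suff FE : x |: F = F by move: xF; rewrite -FE setU11.
apply: maxF (subsetUr _ _); apply: indepU1 => // y yF; exact/negbTE/nx.
Qed.

Lemma mis_intro F : indep e F -> (forall x, x \notin F -> exists2 y, y \in F & e x y) -> mis F.
Proof.
move=> iF dom; apply/maxsetP; split=> // F' /indepP iF' sF.
apply/eqP; rewrite eqEsubset sF andbT; apply/subsetP => x xF'.
apply: contraT => /dom [y yF]; rewrite iF' //; exact: (subsetP sF).
Qed.

Lemma indep_swap F w y : indep e F -> (forall x, x \in F -> e y x -> x = w) ->
  indep e (y |: F :\ w).
Proof.
move=> iF yF; apply: indepU1; first by apply: indepS iF; apply: subD1set.
move=> x /setD1P[xw xF]; apply/negP => /(yF _ xF) xE.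
by rewrite xE eqxx in xw.
Qed.

Lemma card_swap F w y : w \in F -> y \notin F -> #|y |: F :\ w| = #|F|.
Proof.
move=> wF yF; rewrite cardsU1 !inE negb_and yF orbT.
by rewrite (cardsD1 w F) wF.
Qed.

(** * Cycles and cacti *)

Lemma cycle_edgesP (c : seq V) x y : [set x; y] \in cycle_edges c ->
  x \in c /\ (y = next c x \/ x = next c y).
Proof.
case/imsetP => z zc /setP E.
have := E x; have := E y; have := E z; have := E (next c z).
rewrite !inE !eqxx ?orbT /= => nz zz /esym yE /esym xE.
have [xz|] := eqVneq x z.
  rewrite xz; split=> //; left.
  case/orP: yE => /eqP // yz; move: nz; rewrite xz yz orbb => /eqP ->.
  by [].
move=> xz; rewrite (negPf xz) /= in xE; rewrite (eqP xE) mem_next; split=> //.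
case/orP: yE => /eqP yE; first by right; rewrite yE.
by left; rewrite yE; congr (next c _); move: zz; rewrite yE (eqP xE) orbb => /eqP.
Qed.

Lemma cycle_edges_head x y s : [set x; y] \in cycle_edges [:: x, y & s].
Proof.
apply/imsetP; exists x; first by rewrite mem_head.
by rewrite /= eqxx.
Qed.

Lemma next_last v s : uniq (v :: s) -> next (v :: s) (last v s) = v.
Proof.
by move=> us; rewrite next_nth mem_last index_last // nth_default.
Qed.

Lemma cycle_edges_last v s : uniq (v :: s) -> [set v; last v s] \in cycle_edges (v :: s).
Proof.
move=> us; apply/imsetP; exists (last v s); first exact: mem_last.
by rewrite next_last // setUC.
Qed.

Definition avoid X : rel V := fun x y => [&& e x y, x \notin X & y \notin X].

Lemma avoid_sym X : connect_sym (avoid X).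
Proof. by apply: sym_connect_sym => x y; rewrite /avoid e_sym; congr (_ && _); apply: andbC. Qed.

Lemma connect_avoid X x y : x \notin X -> connect (avoid X) x y -> y \notin X.
Proof.
move=> xX /connectP[p]; elim: p x xX => [|z p IHp] x xX /=; first by move=> _ ->.
by case/andP => /and3P[_ _ zX]; apply: IHp.
Qed.

Lemma path_cycle X v w1 w2 : v \in X -> w1 != w2 -> e v w1 -> e v w2 ->
  w1 \notin X -> connect (avoid X) w1 w2 ->
  exists p, [/\ is_cycle e [:: v, w1 & p], last w1 p = w2 &
                {in w1 :: p, forall x, x \notin X}].
Proof.
move=> vX nw e1 e2 w1X /connectP[p0 p0P w2E].
case: (shortenP p0P) w2E => p pP up _ w2E; exists p.
have pX : {in w1 :: p, forall x, x \notin X}.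
  elim: p w1 {nw e1 p0P w2E up} w1X pP => [|a p IHp] b bX /=.
    by move=> _ x; rewrite inE => /eqP ->.
  case/andP => /and3P[_ _ aX] pP x; rewrite inE => /orP[/eqP ->//|].
  exact: IHp.
split=> //; split.
- by case: p {pP up pX} w2E => //= w2E; rewrite w2E eqxx in nw.
- rewrite cons_uniq up andbT; apply/negP => /pX; rewrite vX //.
rewrite /= e1 /= rcons_path -w2E e_sym e2 andbT.
by apply: sub_path pP => a b /and3P[].
Qed.

Hypothesis cactusE : forall c1 c2 x y, is_cycle e c1 -> is_cycle e c2 -> e x y ->
    [set x; y] \in cycle_edges c1 -> [set x; y] \in cycle_edges c2 ->
    cycle_edges c1 = cycle_edges c2.

Lemma cactus_edges x y s1 s2 : is_cycle e [:: x, y & s1] -> is_cycle e [:: x, y & s2] ->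
  cycle_edges [:: x, y & s1] = cycle_edges [:: x, y & s2].
Proof.
move=> c1 c2; apply: (cactusE c1 c2 (x := x) (y := y)); last 2 first.
- exact: cycle_edges_head.
- exact: cycle_edges_head.
by case: c1 => _ _ /= /andP[].
Qed.

(** An edge determines its cycle. Many configurations below are excluded by two cycles with a common
    first edge and different vertices. *)
Lemma cactus_mem x y s1 s2 z : is_cycle e [:: x, y & s1] -> is_cycle e [:: x, y & s2] ->
  z \in [:: x, y & s1] -> z \in [:: x, y & s2].
Proof.
move=> c1 c2 zc.
have: [set z; next [:: x, y & s1] z] \in cycle_edges [:: x, y & s1] by apply: imset_f.
by rewrite (cactus_edges c1 c2) => /cycle_edgesP[].
Qed.

(** Otherwise two cycles through the edge from [v] to [w1] would return to [v] from different
    neighbours. *)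
Lemma cactus_branch2 v w1 w2 w3 : e v w1 -> e v w2 -> e v w3 ->
  w1 != w2 -> w1 != w3 -> w2 != w3 ->
  connect (avoid [set v]) w1 w2 -> connect (avoid [set v]) w1 w3 -> False.
Proof.
move=> e1 e2 e3 n12 n13 n23 c12 c13.
have w1v : w1 \notin [set v] by rewrite inE eq_sym edge_neq.
have [p [cp lp _]] := path_cycle (set11 v) n12 e1 e2 w1v c12.
have [q [cq lq _]] := path_cycle (set11 v) n13 e1 e3 w1v c13.
have up : uniq [:: v, w1 & p] by case: cp.
have: [set v; w3] \in cycle_edges [:: v, w1 & q].
  by rewrite -lq; apply: (@cycle_edges_last v (w1 :: q)); case: cq.
rewrite -(cactus_edges cp cq) => /cycle_edgesP[_ [w3E|vE]].
  by move: n13; rewrite w3E /= eqxx eqxx.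
have nE : next [:: v, w1 & p] w2 = next [:: v, w1 & p] w3.
  by rewrite -vE -lp; apply: next_last up.
by move/eqP: n23; apply; apply: can_inj (prev_next up) _ _ nE.
Qed.

(** * Basic 5-cycles and simplicial vertices *)

Definition basic5 p1 p2 p3 p4 p5 := [&& uniq [:: p1; p2; p3; p4; p5],
  nbrs2 p2 p1 p3, nbrs2 p4 p3 p5 & nbrs2 p5 p4 p1].

Lemma basic5_rev p1 p2 p3 p4 p5 : basic5 p1 p2 p3 p4 p5 -> basic5 p3 p2 p1 p5 p4.
Proof.
case/and4P => u n2 n4 n5; apply/and4P; split; try exact: nbrs2C.
by rewrite -(rot_uniq 3) -rev_uniq.
Qed.

Lemma basic5_cycle p1 p2 p3 p4 p5 : basic5 p1 p2 p3 p4 p5 -> is_cycle e [:: p1; p2; p3; p4; p5].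
Proof.
case/and4P => u /nbrs2E n2 /nbrs2E n4 /nbrs2E n5; split=> //=.
by rewrite e_sym n2 eqxx n2 eqxx orbT e_sym n4 eqxx n4 eqxx orbT n5 eqxx orbT.
Qed.

Definition simplicial y :=
  [forall a, forall b, [&& e y a, e y b & a != b] ==> e a b].

Lemma simplicialP y : reflect (forall a b, e y a -> e y b -> a != b -> e a b) (simplicial y).
Proof.
apply: (iffP forallP) => [H a b ya yb nab|H a].
  by move/forallP/(_ b): (H a); rewrite ya yb nab.
by apply/forallP => b; apply/implyP => /and3P[]; apply: H.
Qed.

Definition in_simplex v := [exists y, simplicial y && ((v == y) || e y v)].

Definition in_basic5 v := [exists p : V * V * V * V * V,
  let: (p1, p2, p3, p4, p5) := p in
  basic5 p1 p2 p3 p4 p5 && (v \in [:: p1; p2; p3; p4; p5])].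

Lemma in_basic5I p1 p2 p3 p4 p5 v : basic5 p1 p2 p3 p4 p5 ->
  v \in [:: p1; p2; p3; p4; p5] -> in_basic5 v.
Proof. by move=> b vp; apply/existsP; exists (p1, p2, p3, p4, p5); rewrite b. Qed.

Lemma in_basic5E v : in_basic5 v -> exists p1 p2 p3 p4 p5,
  basic5 p1 p2 p3 p4 p5 /\ v \in [:: p1; p2; p3; p4; p5].
Proof.
case/existsP => [[[[[p1 p2] p3] p4] p5]] /andP[b vp].
by exists p1, p2, p3, p4, p5.
Qed.

Definition covered v := in_simplex v || in_basic5 v.

Lemma simplex_swap y w F : simplicial y -> e y w -> indep e F -> w \in F ->
  y \notin F /\ (forall x, x \in F -> e y x -> x = w).
Proof.
move=> /simplicialP sy yw /indepP iF wF; split.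
  by apply/negP => yF; rewrite iF in yw.
move=> x xF yx; apply/eqP; apply: contraT => xw.
by rewrite -(iF x w) // sy.
Qed.

(** If [p4] lies in [F], then [p3] does not and [p2] can replace [p1]; otherwise [p5] can. *)
Lemma basic5_swap p1 p2 p3 p4 p5 F : basic5 p1 p2 p3 p4 p5 -> indep e F -> p1 \in F ->
  exists y, [/\ y \in [:: p2; p5], y \notin F & forall x, x \in F -> e y x -> x = p1].
Proof.
case/and4P => u /nbrs2E n2 /nbrs2E n4 /nbrs2E n5 /indepP iF p1F.
have [p4F|p4F] := boolP (p4 \in F).
  exists p2; split; first by rewrite mem_head.
    by apply/negP => p2F; have := iF _ _ p2F p1F; rewrite n2 eqxx.
  move=> x xF; rewrite n2 => /orP[/eqP->//|/eqP xE]; subst x.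
  by have := iF _ _ p4F xF; rewrite n4 eqxx.
exists p5; split; first by rewrite !inE eqxx orbT.
  by apply/negP => p5F; have := iF _ _ p5F p1F; rewrite n5 eqxx orbT.
by move=> x xF; rewrite n5 => /orP[/eqP xE|/eqP->//]; rewrite -xE xF in p4F.
Qed.

(** [y] is a simplicial vertex whose clique contains [w], or a vertex of degree 2 on a basic 5-cycle
    through [w]. As [v] lies outside this clique or cycle, it is neither equal nor adjacent to
    [y]. *)
Lemma covered_swap v w F : ~~ covered v -> covered w -> e v w -> indep e F -> w \in F ->
  exists y, [/\ y \notin F, y != v, e y v = false & forall x, x \in F -> e y x -> x = w].
Proof.
rewrite negb_or => /andP[vA vC] /orP[/existsP[y /andP[sy wy]]|/in_basic5E].
  move=> vw iF wF.
  have yv : ~~ ((v == y) || e y v).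
    by apply: contra vA => yv; apply/existsP; exists y; rewrite sy.
  move: yv; rewrite negb_or => /andP[nvy /negbTE nyv].
  have yw : e y w.
    by case/orP: wy => [/eqP wE|//]; rewrite wE e_sym nyv in vw.
  have [yF yP] := simplex_swap sy yw iF wF.
  by exists y; split=> //; rewrite eq_sym.
move=> [p1 [p2 [p3 [p4 [p5 [b wp]]]]]] vw iF wF.
have vp : v \notin [:: p1; p2; p3; p4; p5].
  by apply: contra vC => vp; apply: in_basic5I b vp.
case/and4P: (b) => u /nbrs2E n2 /nbrs2E n4 /nbrs2E n5.
have: (w == p1) || (w == p3).
  move: (vp); rewrite !inE !negb_or => /and5P[/negPf v1 _ /negPf v3 /negPf v4 /negPf v5].
  move: wp vw; rewrite !inE e_sym => /orP[->//|/or4P[]/eqP->]; rewrite ?eqxx ?orbT //.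
  - by rewrite n2 v1 v3.
  - by rewrite n4 v3 v5.
  - by rewrite n5 v4 v1.
have main q1 q2 q3 q4 q5 : basic5 q1 q2 q3 q4 q5 -> q1 \in F ->
    v \notin [:: q1; q2; q3; q4; q5] ->
    exists y, [/\ y \notin F, y != v, e y v = false & forall x, x \in F -> e y x -> x = q1].
  move=> bq q1F vq; have [y [yq yF yP]] := basic5_swap bq iF q1F.
  case/and4P: (bq) => _ /nbrs2E m2 _ /nbrs2E m5.
  exists y; split=> //; move: vq; rewrite !inE !negb_or; move: yq; rewrite !inE.
    by case/orP=> /eqP-> /and5P[_ ? _ _ ?]; rewrite eq_sym.
  by case/orP=> /eqP-> /and5P[/negPf v1 _ /negPf v3 /negPf v4 _]; rewrite ?m2 ?m5 ?v1 ?v3 ?v4.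
case/orP=> /eqP wE; subst w; first exact: main b _ _.
apply: main (basic5_rev b) _ _ => //.
by apply: contra vp; rewrite !inE => /or4P[->|->|->|/orP[]->]; rewrite ?orbT.
Qed.

(** * Well-covered cacti *)

Hypothesis wc : forall F F', mis F -> indep e F' -> (#|F'| <= #|F|)%N.

Lemma mis_card F F' : mis F -> indep e F' -> (#|F| <= #|F'|)%N -> mis F'.
Proof.
move=> mF iF' leF; apply/maxsetP; split=> // B iB sB.
by apply/eqP; rewrite eq_sym eqEcard sB (leq_trans (wc mF iB)).
Qed.

Lemma mis_swap F w y : mis F -> w \in F -> y \notin F ->
  (forall x, x \in F -> e y x -> x = w) -> mis (y |: F :\ w).
Proof.
move=> mF wF yF yP; have [iF _] := maxsetP mF.
by apply: (mis_card mF); [apply: indep_swap|rewrite card_swap].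
Qed.

(** * Gluing independent sets at a cut vertex *)

Section Glue.
Variables (v : V) (D : {set V}).
Hypothesis vD : v \notin D.
Hypothesis Dcl : forall x y, x \in D -> e x y -> y != v -> y \in D.

(** [A] on the side [D] of the cut vertex, [B] on the other side, to which [v] belongs. *)
Definition glue (A B : {set V}) := (A :&: D) :|: (B :\: D).

Lemma card_glue A B : #|glue A B| = (#|A :&: D| + #|B :\: D|)%N.
Proof.
rewrite cardsU [X in (_ - X)%N](_ : _ = 0%N) ?subn0 //.
by apply/eqP; rewrite cards_eq0 -subset0; apply/subsetP => x; rewrite !inE; case: (x \in D); rewrite ?andbF.
Qed.

Lemma indep_glue A B : indep e A -> indep e B -> (v \in B -> v \in A) -> indep e (glue A B).
Proof.
move=> /indepP iA /indepP iB vAB.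
have cross x y : x \in A :&: D -> y \in B :\: D -> e x y = false.
  rewrite !inE => /andP[xA xD] /andP[yD yB]; apply/negP => exy.
  have yv : y = v.
    by apply/eqP; apply: contraNT yD; apply: Dcl exy.
  by move: exy; rewrite iA // yv vAB // -yv.
apply/indepP => x y /setUP[xA|xB] /setUP[yA|yB].
- by move: xA yA => /setIP[xA _] /setIP[yA _]; apply: iA.
- exact: cross.
- by rewrite e_sym cross.
- by move: xB yB => /setDP[xB _] /setDP[yB _]; apply: iB.
Qed.

(** Domination by a vertex other than [v] survives gluing, since such a neighbour of [x] lies on the
    same side when [x] is not [v]. *)
Definition dominates (A : {set V}) x := [exists y in A, (y != v) && e x y].

Lemma mis_glue A B : indep e A -> indep e B -> v \notin B ->
  (forall x, x \in D -> x \notin A -> dominates A x) ->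
  (forall x, x \notin D -> x != v -> x \notin B -> dominates B x) ->
  (exists2 x, e v x & x \in glue A B) -> mis (glue A B).
Proof.
move=> iA iB vB domA domB [x0 vx0 x0G]; apply: mis_intro.
  by apply: indep_glue => // /(negP vB).
move=> x xG; have [xE|xv] := eqVneq x v; first by exists x0; rewrite // xE.
move: xG; rewrite !inE negb_or !negb_and; have [xD|xD] := boolP (x \in D).
  rewrite orbF /= andbT => xA.
  have /exists_inP[y yA /andP[yv exy]] := domA x xD xA; exists y => //.
  by rewrite !inE yA (Dcl xD exy yv).
rewrite orbT /= => xB.
have /exists_inP[y yB /andP[yv exy]] := domB x xD xv xB; exists y => //.
rewrite !inE yB andbT orbC (_ : y \notin D) //; apply: contra xD => yD.
by apply: (Dcl yD) xv; rewrite e_sym.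
Qed.

Lemma mis_dominates F x : mis F -> v \notin F -> x \notin F -> dominates F x.
Proof.
move=> mF vF /(mis_dom mF)[y yF exy]; apply/exists_inP; exists y => //.
by rewrite exy andbT; apply: contraNneq vF => <-.
Qed.

Variables (y0 : V).
Hypothesis (vy0 : e v y0) (y0D : y0 \notin D).

Lemma no_nbr_mis : exists F, [/\ mis F, v \notin F & y0 \in F].
Proof.
have [F mF /subsetP sF] := mis_ext (indep1 y0); have y0F : y0 \in F by apply: sF; rewrite inE.
exists F; split=> //; apply/negP => vF.
by move: vy0; rewrite (mis_indep mF vF y0F).
Qed.

(* A maximal independent set containing [v] and [P] stays maximal on both sides without [v], so
   exchanging one side for a set meeting the neighbourhood of [v] changes the size by one. *)
Lemma cut_vertex_domination x0 P : e v x0 -> x0 \in D ->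
  indep e P -> {in P, forall z, (z != v) && ~~ e v z} ->
  (forall w, e v w -> exists2 z, z \in P & e w z) -> False.
Proof.
move=> vx0 x0D iP Pv Pdom.
have iP1 : indep e (v |: P) by apply: indepU1 => // z /Pv /andP[_ /negbTE].
have [F1 mF1 /subsetP sF1] := mis_ext iP1.
have vF1 : v \in F1 by apply: sF1; rewrite !inE eqxx.
have PF1 z : z \in P -> z \in F1 by move=> zP; apply: sF1; rewrite !inE zP orbT.
have [F3 [mF3 vF3 y0F3]] := no_nbr_mis.
have [F4 mF4 /subsetP sF4] := mis_ext (indep1 x0).
have x0F4 : x0 \in F4 by apply: sF4; rewrite inE.
have vF4 : v \notin F4 by apply/negP => vF; rewrite (mis_indep mF4 vF x0F4) in vx0.
have [iF1 _] := maxsetP mF1; have [iF3 _] := maxsetP mF3; have [iF4 _] := maxsetP mF4.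
have dom1 x : x \notin F1 -> dominates F1 x.
  move=> /(mis_dom mF1)[y yF exy]; apply/exists_inP.
  have [yv|yv] := eqVneq y v; last by exists y; rewrite ?yv.
  have [|z zP exz] := Pdom x; first by rewrite e_sym -yv.
  by exists z; [apply: PF1|rewrite exz andbT; case/andP: (Pv _ zP)].
have G2 : mis (glue F1 F3).
  apply: mis_glue => // [x _|x _ _|]; first exact: dom1.
    exact: mis_dominates.
  by exists y0; rewrite // !inE y0F3 y0D orbT.
have G6 : mis (glue F4 F3).
  apply: mis_glue => // [x _|x _ _|]; try exact: mis_dominates.
  by exists y0; rewrite // !inE y0F3 y0D orbT.
have G5 : mis (glue F4 (F1 :\ v)).
  apply: mis_glue => //; first by apply: indepS iF1; apply: subD1set.
  - by rewrite !inE eqxx.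
  - by move=> x _; apply: mis_dominates.
  - move=> x _ xv; rewrite !inE xv /= => /dom1 /exists_inP[y yF /andP[yv exy]].
    by apply/exists_inP; exists y; rewrite ?inE ?yv.
  by exists x0; rewrite // !inE x0F4 x0D.
(* [G2] and [G6] agree outside [D], so [F1] and [F4] have equally many vertices in [D]; hence [G5]
   is smaller than [F1] by exactly the vertex [v]. *)
have [iG2 _] := maxsetP G2; have [iG6 _] := maxsetP G6; have [iG5 _] := maxsetP G5.
have c1 := wc G2 iG6; have c2 := wc G6 iG2; have c3 := wc mF1 iG5; have c4 := wc G5 iF1.
have cF1 : (#|F1 :&: D| + #|F1 :\: D| = #|F1|)%N by rewrite cardsID.
have cF1v : (#|F1 :\: D| = #|(F1 :\ v) :\: D|.+1)%N.
  rewrite (cardsD1 v (F1 :\: D)) !inE vF1 vD; congr (_.+1).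
  by apply: eq_card => x; rewrite !inE andbCA.
move: c1 c2 c3 c4 cF1 cF1v; rewrite !card_glue.
move: #|F1 :&: D| #|F3 :\: D| #|F4 :&: D| #|F1| #|(F1 :\ v) :\: D| #|F1 :\: D|.
clear; lia.
Qed.

(** [v w z z' w'] is a 5-cycle with [w] and [w'] of degree 2. On the side [D], [F1] can trade [v]
    for both [w] and [w'], while [F2] becomes maximal by trading [v] for [w'] alone; yet [F2] has at
    most as many vertices in [D] as [F1]. *)
Lemma cut_vertex_5cycle w w' z z' x x' :
  w != w' -> w \in D -> w' \in D ->
  {in D, forall t, e v t -> (t == w) || (t == w')} ->
  nbrs2 w v z -> nbrs2 w' v z' -> z != w' -> z \in D ->
  e z x -> e z' x' -> x \in D -> x' \in D -> ~~ e v x -> ~~ e v x' -> ~~ e x x' ->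
  ~~ e v z -> e z z' -> False.
Proof.
move=> nww wD w'D vN /nbrs2E Nw /nbrs2E Nw' nzw' zD zx z'x' xD x'D vx vx' xx' vz zz'.
have neqv t : t \in D -> t != v by apply: contraTneq => ->.
have iE1 : indep e (v |: [set x; x']).
  apply: indepU1; first by apply: indep2; apply/negbTE.
  by move=> t /set2P[]->; apply/negbTE.
have [F1 mF1 /subsetP sF1] := mis_ext iE1.
have [F2 mF2 /subsetP sF2] := mis_ext (indep2 (negbTE vz)).
have [F3 [mF3 vF3 y0F3]] := no_nbr_mis.
have vF1 : v \in F1 by apply: sF1; rewrite !inE eqxx.
have xF1 : x \in F1 by apply: sF1; rewrite !inE eqxx !orbT.
have x'F1 : x' \in F1 by apply: sF1; rewrite !inE eqxx !orbT.
have vF2 : v \in F2 by apply: sF2; rewrite !inE eqxx.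
have zF2 : z \in F2 by apply: sF2; rewrite !inE eqxx !orbT.
have [iF1 _] := maxsetP mF1; have [iF2 _] := maxsetP mF2; have [iF3 _] := maxsetP mF3.
have vw : e v w by rewrite e_sym Nw eqxx.
have vw' : e v w' by rewrite e_sym Nw' eqxx.
have ww' : e w w' = false.
  by rewrite Nw eq_sym [w' == z]eq_sym (negPf nzw') orbF; apply/negP => /eqP vE; rewrite -vE eirr in vw'.
have wF1 : w \notin F1 by apply/negP => wF; rewrite (mis_indep mF1 vF1 wF) in vw.
have w'F1 : w' \notin F1 by apply/negP => wF; rewrite (mis_indep mF1 vF1 wF) in vw'.
have w'F2 : w' \notin F2 by apply/negP => wF; rewrite (mis_indep mF2 vF2 wF) in vw'.
have iA1 : indep e (w |: (w' |: F1 :\ v)).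
  apply: indepU1; first apply: indepU1.
  - by apply: indepS iF1; apply: subD1set.
  - move=> t /setD1P[tv tF]; rewrite Nw' (negPf tv) /=; apply/negP => /eqP tE.
    by move: z'x'; rewrite -tE (mis_indep mF1 tF x'F1).
  - move=> t; rewrite !inE => /orP[/eqP->//|/andP[tv tF]].
    rewrite Nw (negPf tv) /=; apply/negP => /eqP tE.
    by move: zx; rewrite -tE (mis_indep mF1 tF xF1).
have iA2 : indep e (w' |: F2 :\ v).
  apply: indepU1; first by apply: indepS iF2; apply: subD1set.
  move=> t /setD1P[tv tF]; rewrite Nw' (negPf tv) /=; apply/negP => /eqP tE.
  by move: zz'; rewrite -tE (mis_indep mF2 zF2 tF).
have iG1 : indep e (glue (w |: (w' |: F1 :\ v)) F3).
  by apply: indep_glue => // vF; rewrite vF in vF3.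
have G2 : mis (glue (w' |: F2 :\ v) F3).
  apply: mis_glue => //; last by exists y0; rewrite // !inE y0F3 y0D orbT.
    move=> t tD; rewrite !inE negb_or negb_and negbK (negPf (neqv _ tD)) /= => /andP[tw' tF].
    have [u uF etu] := mis_dom mF2 tF; apply/exists_inP.
    have [uv|uv] := eqVneq u v.
      have: (t == w) || (t == w') by apply: vN; rewrite // e_sym -uv.
      rewrite (negPf tw') orbF => /eqP tE; exists z; first by rewrite !inE zF2 (neqv z) ?orbT.
      by rewrite tE Nw eqxx orbT neqv.
    by exists u; rewrite ?etu ?uv // !inE uv uF orbT.
  by move=> t _ _; apply: mis_dominates.
have g1 := wc mF1 (indep_glue iF2 iF1 (fun _ => vF2)).
have g2 := wc G2 iG1.
have cF1 : (#|F1 :&: D| + #|F1 :\: D| = #|F1|)%N by rewrite cardsID.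
have cA1 : #|(w |: (w' |: F1 :\ v)) :&: D| = #|F1 :&: D|.+2.
  have -> : (w |: (w' |: F1 :\ v)) :&: D = w |: (w' |: F1 :&: D).
    apply/setP => t; rewrite !inE; have [->|_] := eqVneq t w; first by rewrite wD.
    have [->|_] := eqVneq t w'; first by rewrite w'D.
    by have [->|_] := eqVneq t v; rewrite /= ?(negPf vD) ?andbF.
  by rewrite !cardsU1 !inE negb_or nww (negPf wF1) (negPf w'F1).
have cA2 : #|(w' |: F2 :\ v) :&: D| = #|F2 :&: D|.+1.
  have -> : (w' |: F2 :\ v) :&: D = w' |: F2 :&: D.
    apply/setP => t; rewrite !inE; have [->|_] := eqVneq t w'; first by rewrite w'D.
    by have [->|_] := eqVneq t v; rewrite /= ?(negPf vD) ?andbF.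
  by rewrite !cardsU1 !inE (negPf w'F2).
move: g1 g2 cF1; rewrite !card_glue cA1 cA2.
move: #|F1 :&: D| #|F3 :\: D| #|F2 :&: D| #|F1| #|F1 :\: D|.
clear; lia.
Qed.

End Glue.

(** Otherwise [a] is a leaf, hence simplicial, and [v] lies in its closed neighbourhood. *)
Lemma leaf_or_nbr v a : e v a -> ~~ in_simplex v -> exists2 z, e a z & z != v.
Proof.
move=> va vA; apply/exists_inP; apply: contraNT vA; rewrite negb_exists_in => /forall_inP Na.
apply/existsP; exists a; rewrite [e a v]e_sym va orbT andbT; apply/simplicialP => x y ax ay.
by have := Na x ax; have := Na y ay; rewrite !negbK => /eqP-> /eqP->; rewrite eqxx.
Qed.

Lemma triangle_or_nbr v a b : e v a -> e v b -> e a b -> ~~ in_simplex v ->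
  exists2 z, e a z & (z != v) && (z != b).
Proof.
move=> va vb ab vA; apply/exists_inP; apply: contraNT vA; rewrite negb_exists_in => /forall_inP Na.
apply/existsP; exists a; rewrite [e a v]e_sym va orbT andbT; apply/simplicialP => x y ax ay.
have := Na x ax; have := Na y ay; rewrite !negb_and !negbK.
by move=> /orP[]/eqP-> /orP[]/eqP->; rewrite ?eqxx // ?vb // e_sym vb.
Qed.

Lemma not_simplicialP v : ~~ simplicial v ->
  exists w w', [/\ e v w, e v w', w != w' & e w w' = false].
Proof.
rewrite negb_forall => /existsP[w]; rewrite negb_forall => /existsP[w'].
rewrite negb_imply => /andP[/and3P[vw vw' nww] /negbTE ww'].
by exists w, w'.
Qed.

Lemma nbrs2_or_third x y z : e x y -> e x z ->
  nbrs2 x y z \/ exists t, [/\ e x t, t != y & t != z].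
Proof.
move=> xy xz; case: (boolP (nbrs2 x y z)) => [|/forallPn[t]]; first by left.
rewrite !inE => nt; right; exists t.
have [tE|ty] := eqVneq t y; first by rewrite tE eqxx xy in nt.
have [tE|tz] := eqVneq t z; first by rewrite tE eqxx xz orbT in nt.
by move: nt; rewrite (negPf ty) (negPf tz) /= eqbF_neg negbK.
Qed.

(** A third neighbour makes [v] a cut vertex. In each component of the graph without [v], an
    independent set of non-neighbours of [v] is found that dominates the neighbours of [v] there;
    the union contradicts [cut_vertex_domination]. The one shape of component for which the
    construction fails contradicts [cut_vertex_5cycle]. *)
Lemma uncovered_nbrs2 v : ~~ covered v ->
  exists w w', [/\ nbrs2 v w w', w != w' & e w w' = false].
Proof.
rewrite negb_or => /andP[vA vC].
have [w [w' [vw vw' nww ww']]] : exists w w', [/\ e v w, e v w', w != w' & e w w' = false].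
  by apply: not_simplicialP; apply: contra vA => sv; apply/existsP; exists v; rewrite sv eqxx.
have [|[w3 [vw3 n31 n32]]] := nbrs2_or_third vw vw'; first by exists w, w'.
exfalso.
set R := avoid [set v].
have Rsym : connect_sym R := avoid_sym _.
(* By the cactus property a component contains at most two neighbours of [v]. *)
have three r a b c : e v a -> e v b -> e v c -> a != b -> a != c -> b != c ->
    connect R r a -> connect R r b -> connect R r c -> False.
  move=> va vb vc ab ac bc ra rb rc; apply: (cactus_branch2 va vb vc ab ac bc).
    by apply: connect_trans rb; rewrite [connect _ _ _]Rsym.
  by apply: connect_trans rc; rewrite [connect _ _ _]Rsym.
have vneq t : e v t -> t \notin [set v] by move=> vt; rewrite inE eq_sym edge_neq.
have RE x y : e x y -> x != v -> y != v -> connect R x y.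
  by move=> exy xv yv; apply: connect1; rewrite /R /avoid exy !inE xv yv.
have Rcl r x y : connect R r x -> x != v -> e x y -> y != v -> connect R r y.
  by move=> rx xv exy yv; apply: connect_trans rx _; apply: RE.
have other a b r : e v a -> e v b -> a != b -> connect R r a -> connect R r b ->
    exists2 y0, e v y0 & ~~ connect R r y0.
  move=> va vb nab ra rb; apply/exists_inP; apply: contraT.
  rewrite negb_exists_in => /forall_inP H.
  have {}H t : e v t -> connect R r t by move=> vt; have := H t vt; rewrite negbK.
  exfalso; apply: (three r w w' w3) => //; rewrite 1?eq_sym //; exact: H.
have comps r : exists P : {set V}, [/\ indep e P,
    {in P, forall z, [&& connect R r z, z != v & ~~ e v z]} &
    forall t, e v t -> connect R r t -> exists2 z, z \in P & e t z].
  have [a /andP[va ra]|no] := pickP (fun a => e v a && connect R r a); last first.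
    exists set0; split=> [|z|t vt rt]; rewrite ?inE //.
      by apply/indepP => x y; rewrite inE.
    by have := no t; rewrite vt rt.
  have av : a != v by rewrite eq_sym edge_neq.
  have [b /and3P[vb rb ba]|no] := pickP (fun b => [&& e v b, connect R r b & b != a]); last first.
    have [z az zv] := leaf_or_nbr va vA.
    have rz : connect R r z by apply: Rcl az zv.
    exists [set z]; split=> [|t /set1P ->|t vt rt].
    - exact: indep1.
    - rewrite rz zv /=; apply/negP => vz; have := no z.
      by rewrite vz rz eq_sym edge_neq.
    - exists z; first by rewrite inE.
      by have := no t; rewrite vt rt /= => /negbFE /eqP ->.
  have bv : b != v by rewrite eq_sym edge_neq.
  have ab : a != b by rewrite eq_sym.
  have onlyab t : e v t -> connect R r t -> (t == a) || (t == b).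
    move=> vt rt; apply: contraT; rewrite negb_or => /andP[ta tb]; exfalso.
    by apply: (three r a b t) => //; rewrite eq_sym.
  have nvz z : connect R r z -> z != a -> z != b -> ~~ e v z.
    move=> rz za zb; apply/negP => vz; have := onlyab z vz rz.
    by rewrite (negPf za) (negPf zb).
  have finish P : indep e P -> {in P, forall z, [/\ connect R r z, z != v, z != a & z != b]} ->
      (exists2 z, z \in P & e a z) -> (exists2 z, z \in P & e b z) ->
    exists P : {set V}, [/\ indep e P,
      {in P, forall z, [&& connect R r z, z != v & ~~ e v z]} &
      forall t, e v t -> connect R r t -> exists2 z, z \in P & e t z].
    move=> iP HP Pa Pb; exists P; split=> //.
      by move=> z /HP[rz zv za zb]; rewrite rz zv nvz.
    by move=> t vt rt; case/orP: (onlyab t vt rt) => /eqP->.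
  (* In a triangle [v a b], further neighbours of [a] and of [b] are distinct and non-adjacent,
     since otherwise a second cycle would contain the edge [a b]. *)
  have [eab|neab] := boolP (e a b).
    have [z az /andP[zv zb]] := triangle_or_nbr va vb eab vA.
    have eba : e b a by rewrite e_sym.
    have [z' bz' /andP[z'v z'a]] := triangle_or_nbr vb va eba vA.
    have za : z != a by rewrite eq_sym edge_neq.
    have z'b : z' != b by rewrite eq_sym edge_neq.
    have cv : is_cycle e [:: a; b; v].
      by split; rewrite //= ?inE ?negb_or ?ab ?av ?bv // eab va e_sym vb.
    have neqz : z != z'.
      apply/negP => /eqP zE.
      have cz : is_cycle e [:: a; b; z].
        by split; rewrite //= ?inE ?negb_or ?ab 1?eq_sym ?za 1?eq_sym ?zb // eab zE bz' -zE e_sym az.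
      have: v \in [:: a; b; z] by apply: (cactus_mem cv cz); rewrite !inE eqxx !orbT.
      by rewrite !inE eq_sym (negPf av) eq_sym (negPf bv) eq_sym (negPf zv).
    have nzz : e z z' = false.
      apply/negP => zz'.
      have cz : is_cycle e [:: a; b; z'; z].
        by split; rewrite //= ?inE ?negb_or ?ab ?[a == _]eq_sym ?z'a ?za ?[b == _]eq_sym ?z'b ?zb 1?eq_sym ?neqz // eab bz' [e z' z]e_sym zz' e_sym az.
      have: v \in [:: a; b; z'; z] by apply: (cactus_mem cv cz); rewrite !inE eqxx !orbT.
      by rewrite !inE ![v == _]eq_sym (negPf av) (negPf bv) (negPf zv) (negPf z'v).
    apply: (finish [set z; z']).
    - exact: indep2.
    - by move=> t /set2P[]->; split=> //; [apply: Rcl az zv|apply: Rcl bz' z'v].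
    - by exists z; rewrite // !inE eqxx.
    - by exists z'; rewrite // !inE eqxx orbT.
  have [z /and3P[az bz zv]|nocommon] := pickP (fun z => [&& e a z, e b z & z != v]).
    apply: (finish [set z]); first exact: indep1.
    - move=> t /set1P ->; split; rewrite ?zv //; first by apply: Rcl az zv.
        by rewrite eq_sym edge_neq.
      by rewrite eq_sym edge_neq.
    - by exists z; rewrite ?inE.
    - by exists z; rewrite ?inE.
  have [[z z'] /= /and5P[az bz' zv z'v /negbTE zz']|alladj] :=
      pickP (fun p : V * V => [&& e a p.1, e b p.2, p.1 != v, p.2 != v & ~~ e p.1 p.2]).
    apply: (finish [set z; z']); first exact: indep2.
    - move=> t /set2P[]->; split=> //.
      + by apply: Rcl az zv.
      + by rewrite eq_sym edge_neq.
      + by apply: contraNneq neab => <-.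
      + by apply: Rcl bz' z'v.
      + by apply: contraNneq neab => <-; rewrite e_sym.
      + by rewrite eq_sym edge_neq.
    - by exists z; rewrite // !inE eqxx.
    - by exists z'; rewrite // !inE eqxx orbT.
  (* Now every further neighbour of [a] is adjacent to every further neighbour of [b]. This gives a
     5-cycle through [v], on which [a] and [b] have degree 2 by the cactus property. *)
  exfalso.
  have [z az zv] := leaf_or_nbr va vA; have [z' bz' z'v] := leaf_or_nbr vb vA.
  have adj t t' : e a t -> e b t' -> t != v -> t' != v -> e t t'.
    by move=> at1 bt tv t'v; have := alladj (t, t'); rewrite /= at1 bt tv t'v => /negbFE.
  have zz' := adj _ _ az bz' zv z'v.
  have za : z != a by rewrite eq_sym edge_neq.
  have z'b : z' != b by rewrite eq_sym edge_neq.
  have zb : z != b by apply: contraNneq neab => <-.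
  have z'a : z' != a by apply: contraNneq neab => <-; rewrite e_sym.
  have neqz : z != z' by apply: edge_neq.
  have c5 : is_cycle e [:: a; z; z'; b; v].
    split; rewrite //= ?inE ?negb_or.
      by rewrite ![a == _]eq_sym za z'a ba neqz zb zv z'b z'v bv [v == a]eq_sym av.
    by rewrite az zz' [e z' b]e_sym bz' [e b v]e_sym vb va.
  have c5' : is_cycle e [:: b; z'; z; a; v].
    split; rewrite //= ?inE ?negb_or.
      by rewrite ![b == _]eq_sym zb z'b ab [z' == z]eq_sym neqz za zv z'a z'v av [v == b]eq_sym bv.
    by rewrite bz' [e z' z]e_sym zz' [e z a]e_sym az [e a v]e_sym va vb.
  have naz' : e a z' = false by have := nocommon z'; rewrite bz' z'v /= andbT.
  have nbz : e b z = false by have := nocommon z; rewrite az zv /= andbT.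
  have av' : e a v by rewrite e_sym.
  have bv' : e b v by rewrite e_sym.
  have Na : nbrs2 a v z.
    have [//|[t [eat tv tz]]] := nbrs2_or_third av' az; exfalso.
    have tz' : t != z' by apply: contraTneq eat => ->; rewrite naz'.
    have ta : t != a by rewrite eq_sym edge_neq.
    have c4 : is_cycle e [:: a; z; z'; t].
      split; rewrite //= ?inE ?negb_or.
        by rewrite ![a == _]eq_sym za z'a ta neqz [z == t]eq_sym tz [z' == t]eq_sym tz'.
      by rewrite az zz' [e z' t]e_sym adj // e_sym eat.
    have: v \in [:: a; z; z'; t] by apply: (cactus_mem c5 c4); rewrite !inE eqxx !orbT.
    by rewrite !inE ![v == _]eq_sym (negPf av) (negPf zv) (negPf z'v) (negPf tv).
  have Nb : nbrs2 b v z'.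
    have [//|[t [ebt tv tz']]] := nbrs2_or_third bv' bz'; exfalso.
    have tz : t != z by apply: contraTneq ebt => ->; rewrite nbz.
    have tb : t != b by rewrite eq_sym edge_neq.
    have c4 : is_cycle e [:: b; z'; z; t].
      split; rewrite //= ?inE ?negb_or.
        by rewrite ![b == _]eq_sym zb z'b tb [z' == z]eq_sym neqz [z == t]eq_sym tz [z' == t]eq_sym tz'.
      by rewrite bz' [e z' z]e_sym zz' adj // e_sym ebt.
    have: v \in [:: b; z'; z; t] by apply: (cactus_mem c5' c4); rewrite !inE eqxx !orbT.
    by rewrite !inE ![v == _]eq_sym (negPf bv) (negPf zv) (negPf z'v) (negPf tv).
  have u5 : uniq [:: v; b; z'; z; a].
    by rewrite -rev_uniq -(rot_uniq 4); case: c5' => _; rewrite -rev_uniq -(rot_uniq 1).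
  have u5' : uniq [:: v; a; z; z'; b].
    by rewrite -(rot_uniq 1); case: c5.
  (* If [z] had degree 2, the 5-cycle would be basic and would cover [v]; likewise for [z']. *)
  have [x [zx xa xz']] : exists x, [/\ e z x, x != a & x != z'].
    have [Nz|//] := nbrs2_or_third (etrans (e_sym z a) az) zz'; exfalso.
    move/negP: vC; apply; apply: (@in_basic5I v b z' z a); rewrite ?mem_head //.
    by rewrite /basic5 u5 Nb (nbrs2C Nz) (nbrs2C Na).
  have [x' [z'x' x'b x'z]] : exists x, [/\ e z' x, x != b & x != z].
    have [Nz|//] := nbrs2_or_third (etrans (e_sym z' b) bz') (etrans (e_sym z' z) zz'); exfalso.
    move/negP: vC; apply; apply: (@in_basic5I v a z z' b); rewrite ?mem_head //.
    by rewrite /basic5 u5' Na (nbrs2C Nz) (nbrs2C Nb).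
  have vz : ~~ e v z by apply: nvz => //; apply: Rcl az zv.
  have vz' : ~~ e v z' by apply: nvz => //; apply: Rcl bz' z'v.
  have xv : x != v by apply: contraNneq vz => <-; rewrite e_sym.
  have x'v : x' != v by apply: contraNneq vz' => <-; rewrite e_sym.
  have xb : x != b by apply: contraTneq zx => ->; rewrite e_sym nbz.
  have x'a : x' != a by apply: contraTneq z'x' => ->; rewrite e_sym naz'.
  have xz : x != z by rewrite eq_sym edge_neq.
  have x'z' : x' != z' by rewrite eq_sym edge_neq.
  have rz : connect R r z by apply: Rcl az zv.
  have rz' : connect R r z' by apply: Rcl bz' z'v.
  have rx : connect R r x by apply: Rcl zx xv.
  have rx' : connect R r x' by apply: Rcl z'x' x'v.
  have c5z : is_cycle e [:: z; z'; b; v; a].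
    case: c5 => _ u5z c5z; split=> //; first by rewrite -(rot_uniq 4).
    by rewrite -(rot_cycle 4).
  have nxx : x != x'.
    apply/negP => /eqP xE.
    have c3 : is_cycle e [:: z; z'; x].
      split; rewrite //= ?inE ?negb_or ?neqz ?[z == _]eq_sym ?xz ?[z' == _]eq_sym ?xz' //.
      by rewrite zz' [e x z]e_sym zx xE z'x'.
    have: v \in [:: z; z'; x] by apply: (cactus_mem c5z c3); rewrite !inE eqxx !orbT.
    by rewrite !inE ![v == _]eq_sym (negPf zv) (negPf z'v) (negPf xv).
  have nexx : ~~ e x x'.
    apply/negP => exx.
    have c4 : is_cycle e [:: z; z'; x'; x].
      split; rewrite //= ?inE ?negb_or ?neqz ?[z == _]eq_sym ?xz ?x'z ?[z' == _]eq_sym ?xz' ?x'z' ?[x' == _]eq_sym ?nxx //.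
      by rewrite zz' z'x' [e x' x]e_sym exx [e x z]e_sym zx.
    have: v \in [:: z; z'; x'; x] by apply: (cactus_mem c5z c4); rewrite !inE eqxx !orbT.
    by rewrite !inE ![v == _]eq_sym (negPf zv) (negPf z'v) (negPf xv) (negPf x'v).
  have [y0 vy0 ry0] := other a b r va vb ab ra rb.
  pose D := [set x | connect R r x].
  have vD : v \notin D.
    rewrite inE; apply/negP => rv.
    have /(connect_avoid (vneq _ va)) : connect R a v.
      by apply: connect_trans rv; rewrite Rsym.
    by rewrite inE eqxx.
  apply: (@cut_vertex_5cycle v D vD _ y0 vy0 _ a b z z' x x'); rewrite ?inE ?nvz //.
  - move=> s t; rewrite !inE => rs est tv; apply: Rcl est tv => //.
    by apply: contraNneq vD => <-; rewrite inE.
  - by move=> t; rewrite inE => rt vt; apply: onlyab.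
have [Pf PfP] := fin_all_exists comps.
have conn0 r x : connect R (fingraph.root R r) x = connect R r x.
  by apply: same_connect; rewrite // Rsym connect_root.
(* Indexing by component representatives makes all neighbours of [v] in one component use the same
   set. *)
pose P := \bigcup_(r in [set r | e v r]) Pf (fingraph.root R r).
have iP : indep e P.
  apply/indepP => x y /bigcupP[r _ xr] /bigcupP[r' _ yr']; apply/negP => exy.
  have [iPr Pr _] := PfP (fingraph.root R r); have [_ Pr' _] := PfP (fingraph.root R r').
  have /and3P[rx xv _] := Pr _ xr; have /and3P[ry yv _] := Pr' _ yr'.
  rewrite !conn0 in rx ry.
  have rr : fingraph.root R r = fingraph.root R r'.
    apply/eqP; rewrite root_connect //; apply: connect_trans rx _.
    by apply: connect_trans (RE x y exy xv yv) _; rewrite Rsym.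
  by move/indepP: iPr => /(_ x y xr); rewrite rr yr' exy => /(_ isT).
have Pv : {in P, forall z, (z != v) && ~~ e v z}.
  move=> z /bigcupP[r _ zr]; have [_ Pr _] := PfP (fingraph.root R r).
  by have /and3P[_ -> ->] := Pr _ zr.
have Pdom t : e v t -> exists2 z, z \in P & e t z.
  move=> vt; have [_ _ /(_ t vt)] := PfP (fingraph.root R t).
  rewrite conn0 connect0 => /(_ isT)[z zP etz]; exists z => //.
  by apply/bigcupP; exists t; rewrite ?inE.
have [y0 vy0 wy0] : exists2 y0, e v y0 & ~~ connect R w y0.
  have [ww|ww] := boolP (connect R w w'); last by exists w'.
  exact: (other w w' w).
pose D := [set x | connect R w x].
have vD : v \notin D.
  by rewrite inE; apply/negP => /(connect_avoid (vneq _ vw)); rewrite inE eqxx.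
apply: (@cut_vertex_domination v D vD _ y0 vy0 _ w P) => //; rewrite ?inE //.
move=> s t; rewrite !inE => rs est tv; apply: Rcl est tv => //.
by apply: contraNneq vD => <-; rewrite inE.
Qed.

(** * Vertices in no simplex and no basic 5-cycle *)

Hypothesis e_conn : forall x y, connect e x y.
Hypothesis noC4 : forall a b c d, nbrs2 a b d -> nbrs2 b a c -> nbrs2 c b d -> nbrs2 d a c ->
  a != c -> b != d -> False.
Hypothesis noC7 : forall a0 a1 a2 a3 a4 a5 a6, uniq [:: a0; a1; a2; a3; a4; a5; a6] ->
  nbrs2 a0 a6 a1 -> nbrs2 a1 a0 a2 -> nbrs2 a2 a1 a3 -> nbrs2 a3 a2 a4 ->
  nbrs2 a4 a3 a5 -> nbrs2 a5 a4 a6 -> nbrs2 a6 a5 a0 -> False.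

(** [b] and [d] become free once [a] is removed, so trading [a] for both gives an independent set
    larger than [F]. *)
Lemma no_path3 F b' b a d d' : mis F -> a \in F -> nbrs2 b a b' -> nbrs2 d a d' ->
  b != d -> e b d = false -> b' \notin F -> d' \notin F -> False.
Proof.
move=> mF aF /nbrs2E Nb /nbrs2E Nd nbd ebd b'F d'F.
have [iF _] := maxsetP mF.
have bF : b \notin F by apply/negP => bF; have := mis_indep mF bF aF; rewrite Nb eqxx.
have dF : d \notin F by apply/negP => dF; have := mis_indep mF dF aF; rewrite Nd eqxx.
have iG : indep e (b |: (d |: F :\ a)).
  apply: indepU1; first apply: indepU1.
  - by apply: indepS iF; apply: subD1set.
  - move=> t /setD1P[ta tF]; rewrite Nd (negPf ta) /=.
    by apply: contraNF d'F => /eqP <-.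
  - move=> t; rewrite !inE => /orP[/eqP->//|/andP[ta tF]].
    by rewrite Nb (negPf ta) /=; apply: contraNF b'F => /eqP <-.
have := wc mF iG.
rewrite !cardsU1 !inE negb_or nbd (negPf bF) (negPf dF) !andbF /= (cardsD1 a F) aF.
by rewrite ltnn.
Qed.

(** By the exclusion of the 4-cycle, [c] has a further neighbour [x]. A maximal independent set
    containing [x] and [a] omits [c], so [no_path3] applies at [a]. *)
Lemma no_square3 a b c d : nbrs2 a b d -> nbrs2 b a c -> nbrs2 d a c -> a != c -> b != d -> False.
Proof.
move=> Na Nb Nd ac bd.
have [[ea eb] ed] := (nbrs2E Na, nbrs2E Nb, nbrs2E Nd).
have cb : e c b by rewrite e_sym eb eqxx orbT.
have cd : e c d by rewrite e_sym ed eqxx orbT.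
have [Nc|[x [cx xb xd]]] := nbrs2_or_third cb cd; first exact: (noC4 Na Nb Nc Nd).
have xa : e x a = false by rewrite e_sym ea (negPf xb) (negPf xd).
have [F mF /subsetP sF] := mis_ext (indep2 xa).
have xF : x \in F by apply: sF; rewrite !inE eqxx.
have aF : a \in F by apply: sF; rewrite !inE eqxx orbT.
have cF : c \notin F by apply/negP => cF; rewrite (mis_indep mF cF xF) in cx.
apply: (no_path3 mF aF Nb Nd) => //.
rewrite eb; apply/negbTE; rewrite negb_or [d == a]eq_sym [d == c]eq_sym !edge_neq //.
by rewrite ea eqxx orbT.
Qed.

(** [w] is traded for the vertex of [covered_swap], which differs from [v] and has [w] as its only
    neighbour in [F]. *)
Lemma swap_away v w F : ~~ covered v -> covered w -> e v w -> mis F -> w \in F ->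
  exists F', [/\ mis F', v \notin F', w \notin F',
     forall x, x \in F -> x != w -> x \in F' & forall x, x \in F' -> x \notin F -> e x w].
Proof.
move=> vU wA vw mF wF; have [iF _] := maxsetP mF.
have [y [yF yv nyv yP]] := covered_swap vU wA vw iF wF.
exists (y |: F :\ w); split.
- exact: mis_swap.
- rewrite !inE negb_or [v == y]eq_sym yv /=; apply/negP => /andP[_ vF].
  by rewrite (mis_indep mF vF wF) in vw.
- by rewrite !inE eqxx /= orbF; apply: contraNneq yF => <-.
- by move=> x xF xw; rewrite !inE xF xw orbT.
move=> x; rewrite !inE => /orP[/eqP->|/andP[_ ->]//] _.
by have [t tF yt] := mis_dom mF yF; rewrite -(yP t tF yt).
Qed.

(** Suppose both are covered. Swapping [w'] out forces [w] in to dominate [v]; swapping [w] out then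
    leaves only [w'] to dominate [v], but the newcomer is adjacent to [w]. *)
Lemma uncovered_nbrs v w w' : ~~ covered v -> nbrs2 v w w' -> e w w' = false ->
  covered w' -> ~~ covered w.
Proof.
move=> vU Nv ww' w'A; apply/negP => wA.
have Ev := nbrs2E Nv; have vw : e v w by rewrite Ev eqxx.
have vw' : e v w' by rewrite Ev eqxx orbT.
have [F mF /subsetP sF] := mis_ext (indep1 w'); have w'F : w' \in F by apply: sF; rewrite inE.
have [F1 [mF1 vF1 w'F1 _ _]] := swap_away vU w'A vw' mF w'F.
have wF1 : w \in F1.
  have [t tF] := mis_dom mF1 vF1; rewrite Ev => /orP[]/eqP tE; first by rewrite -tE.
  by rewrite tE (negPf w'F1) in tF.
have [F2 [mF2 vF2 wF2 _ newF2]] := swap_away vU wA vw mF1 wF1.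
have [t tF] := mis_dom mF2 vF2; rewrite Ev => /orP[]/eqP tE.
  by rewrite tE (negPf wF2) in tF.
by have := newF2 t tF; rewrite tE w'F1 e_sym ww' => /(_ isT).
Qed.

Lemma uncovered_next x y : ~~ covered y -> e x y ->
  exists z, [/\ nbrs2 y x z, x != z & e x z = false].
Proof.
move=> yU exy; have [w [w' [Ny ww' nww']]] := uncovered_nbrs2 yU.
have := nbrs2E Ny x; rewrite e_sym exy => /esym/orP[]/eqP ->; first by exists w'.
by exists w; rewrite eq_sym e_sym; split=> //; apply: nbrs2C.
Qed.

(** Otherwise a maximal independent set contains [z] and [w']. Once [w'] is swapped out, nothing
    dominates [v], because [z] keeps [w] out. *)
Lemma uncovered_square v w w' : ~~ covered v -> nbrs2 v w w' -> e w w' = false ->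
  covered w' -> exists z, [/\ nbrs2 w v z, v != z & e z w'].
Proof.
move=> vU Nv ww' w'A; have wU := uncovered_nbrs vU Nv ww' w'A.
have Ev := nbrs2E Nv; have vw : e v w by rewrite Ev eqxx.
have vw' : e v w' by rewrite Ev eqxx orbT.
have [z [Nw vz nvz]] := uncovered_next wU vw; exists z; split=> //.
apply: contraT => /negbTE zw'; exfalso.
have wz : e w z by rewrite (nbrs2E Nw) eqxx orbT.
have [F mF /subsetP sF] := mis_ext (indep2 zw').
have zF : z \in F by apply: sF; rewrite !inE eqxx.
have w'F : w' \in F by apply: sF; rewrite !inE eqxx orbT.
have [F1 [mF1 vF1 w'F1 sF1 _]] := swap_away vU w'A vw' mF w'F.
have zF1 : z \in F1 by apply: sF1 => //; apply: contraTneq wz => ->; rewrite ww'.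
have [t tF] := mis_dom mF1 vF1; rewrite Ev => /orP[]/eqP tE.
  by rewrite tE in tF; rewrite (mis_indep mF1 tF zF1) in wz.
by rewrite tE (negPf w'F1) in tF.
Qed.

Definition bad v := ~~ covered v && [forall w, e v w ==> ~~ covered w].

(** If the vertex after [w] were covered, [uncovered_square] would close a 4-cycle with three
    vertices of degree 2. *)
Lemma bad_closed v w : bad v -> e v w -> bad w.
Proof.
move=> /andP[vU /forallP vN] vw.
have {}vN t : e v t -> ~~ covered t by move/implyP: (vN t).
have wU := vN w vw; apply/andP; split=> //; apply/forallP => t; apply/implyP => wt.
have [z [Nw vz nvz]] := uncovered_next wU vw.
move: wt; rewrite (nbrs2E Nw) => /orP[]/eqP-> //; apply/negP => zA.
have [w' [Nv ww' w'z]] := uncovered_square wU Nw nvz zA.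
have vw' : e v w' by rewrite (nbrs2E Nv) eqxx orbT.
have [z' [Nw' vz' _]] := uncovered_next (vN _ vw') vw'.
have zE : z = z'.
  by move: w'z; rewrite (nbrs2E Nw') eq_sym (negPf vz) => /eqP.
by subst z'; apply: (no_square3 Nv Nw Nw').
Qed.

Definition walk x y z := [/\ nbrs2 y x z, x != z & e x z = false].

Lemma walk_edge x y z : walk x y z -> e x y /\ e y z.
Proof. by case=> /nbrs2E Ny _ _; rewrite [e x y]e_sym !Ny !eqxx orbT. Qed.

Lemma walk3 x0 x1 x2 x3 : walk x0 x1 x2 -> walk x1 x2 x3 -> x0 != x3.
Proof.
move=> [_ _ n02] W2; have [_ e23] := walk_edge W2.
by apply: contraFneq n02 => ->; rewrite e_sym.
Qed.

Lemma walk4 p x0 x1 x2 x3 x4 : walk p x0 x1 -> walk x0 x1 x2 -> walk x1 x2 x3 ->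
  walk x2 x3 x4 -> x0 != x4.
Proof.
move=> W0 W1 W2 W3; apply/eqP => xE; subst x4.
have [N0 _ _] := W0; have [N1 n02 _] := W1; have [N2 n13 _] := W2; have [N3 _ _] := W3.
have [_ e30] := walk_edge W3.
have pE : x3 = p.
  by apply/eqP; move: e30; rewrite e_sym (nbrs2E N0) [x3 == x1]eq_sym (negPf n13) orbF.
by subst p; apply: (noC4 (nbrs2C N0) N1 N2 (nbrs2C N3)).
Qed.

Lemma walk_nonadj3 p x0 x1 x2 x3 x4 : walk p x0 x1 -> walk x0 x1 x2 -> walk x1 x2 x3 ->
  walk x2 x3 x4 -> e x0 x3 = false.
Proof.
move=> W0 W1 W2 W3; have n04 := walk4 W0 W1 W2 W3.
have [_ n02 _] := W1; have [N3 _ _] := W3.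
by rewrite e_sym (nbrs2E N3) (negPf n02) (negPf n04).
Qed.

Lemma walk5 p x0 x1 x2 x3 x4 x5 : ~~ covered x0 -> walk p x0 x1 -> walk x0 x1 x2 ->
  walk x1 x2 x3 -> walk x2 x3 x4 -> walk x3 x4 x5 -> x0 != x5.
Proof.
move=> x0U W0 W1 W2 W3 W4; apply/eqP => xE; subst x5.
have [[N0 _ _] [N1 n02 _] [N2 n13 _] [N3 n24 _] [N4 n30 _]] := And5 W0 W1 W2 W3 W4.
have [e01 e12] := walk_edge W1; have [e23 e34] := walk_edge W3.
move/negP: x0U; apply; apply/orP; right.
apply: (@in_basic5I x0 x1 x2 x3 x4); last by rewrite mem_head.
rewrite /basic5 N1 N3 N4 /= !inE !negb_or n02 n13 n24 (walk3 W1 W2) (walk3 W2 W3).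
by rewrite (walk4 W0 W1 W2 W3) !edge_neq.
Qed.

(** By connectedness all vertices would be bad, hence of degree 2. A walk along the resulting cycle
    either contradicts well-coveredness or closes up as a 7-cycle. *)
Lemma not_bad v : ~~ bad v.
Proof.
apply/negP => vB.
have allbad x : bad x.
  have /connectP[p] := e_conn v x; elim: p v vB => [|y p IHp] z zB /=; first by move=> _ ->.
  by case/andP => zy pP xE; apply: IHp pP xE; apply: bad_closed zy.
have allU x : ~~ covered x by case/andP: (allbad x).
have [q [a1 [N0 nq1 eq1]]] := uncovered_nbrs2 (allU v); pose a0 := v.
have W0 : walk q a0 a1 by [].
have [_ e01] := walk_edge W0.
have [a2 W1] := uncovered_next (allU a1) e01; have [_ e12] := walk_edge W1.
have [a3 W2] := uncovered_next (allU a2) e12; have [_ e23] := walk_edge W2.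
have [a4 W3] := uncovered_next (allU a3) e23; have [_ e34] := walk_edge W3.
have [a5 W4] := uncovered_next (allU a4) e34; have [_ e45] := walk_edge W4.
have [a6 W5] := uncovered_next (allU a5) e45; have [_ e56] := walk_edge W5.
have [a7 W6] := uncovered_next (allU a6) e56; have [_ e67] := walk_edge W6.
have n03 := walk_nonadj3 W0 W1 W2 W3; have n36 := walk_nonadj3 W3 W4 W5 W6.
have [[N1 n02 _] [N2 n13 _] [N3 n24 e24] [N4 n35 _] [N5 n46 _]] := And5 W1 W2 W3 W4 W5.
have [N6 n57 _] := W6.
(* If [a0] and [a6] are not adjacent, then [a0], [a3], [a6] are independent and [a3] can be traded
   for [a2] and [a4]. *)
have [e06|n06] := boolP (e a0 a6); last first.
  have iE : indep e (a3 |: [set a0; a6]).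
    apply: indepU1; first exact: indep2 (negbTE n06).
    by move=> t /set2P[]->; rewrite // e_sym.
  have [F mF /subsetP sF] := mis_ext iE.
  have a3F : a3 \in F by apply: sF; rewrite !inE eqxx.
  have a0F : a0 \in F by apply: sF; rewrite !inE eqxx orbT.
  have a6F : a6 \in F by apply: sF; rewrite !inE eqxx !orbT.
  apply: (no_path3 mF a3F (nbrs2C N2) N4 n24 e24).
    by apply/negP => aF; rewrite (mis_indep mF a0F aF) in e01.
  by apply/negP => aF; rewrite (mis_indep mF aF a6F) in e56.
have n05 := walk5 (allU a0) W0 W1 W2 W3 W4.
have n16 := walk5 (allU a1) W1 W2 W3 W4 W5.
have qE : a6 = q.
  by apply/eqP; move: e06; rewrite (nbrs2E N0) [a6 == a1]eq_sym (negPf n16) orbF.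
have a7E : a0 = a7.
  by apply/eqP; move: e06; rewrite e_sym (nbrs2E N6) (negPf n05).
subst q; rewrite -a7E in N6.
apply: (noC7 _ N0 N1 N2 N3 N4 N5 N6).
rewrite /= !inE !negb_or n02 n13 n24 n35 n46 n05 n16.
rewrite (walk3 W1 W2) (walk3 W2 W3) (walk3 W3 W4) (walk3 W4 W5).
by rewrite (walk4 W0 W1 W2 W3) (walk4 W1 W2 W3 W4) (walk4 W2 W3 W4 W5) !edge_neq.
Qed.

(** [not_bad] provides a covered neighbour [d], and [uncovered_square] closes the 4-cycle [a b c d].
    Degree 2 at [c] or [d] would contradict [no_square3]; for [c] this will give level 0. *)
Lemma uncovered_pair a : ~~ covered a -> exists b c d,
  [/\ nbrs2 a b d, nbrs2 b a c & e c d] /\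
  [/\ a != c, b != d, forall s t, ~~ nbrs2 c s t & forall s t, ~~ nbrs2 d s t].
Proof.
move=> aU.
have [d ad dA] : exists2 d, e a d & covered d.
  have := not_bad a; rewrite negb_and aU /= => /forallPn[d].
  by rewrite negb_imply negbK => /andP[ad dA]; exists d.
have [b [Na db ndb]] := uncovered_next aU (etrans (e_sym d a) ad).
rewrite e_sym in ndb; have {}Na := nbrs2C Na.
have [c [Nb ac cd]] := uncovered_square aU Na ndb dA.
have bd : b != d by rewrite eq_sym.
exists b, c, d; split=> //; split=> //.
  move=> s t; apply/negP => Nc.
  have Nc' : nbrs2 c b d.
    apply: nbrs2P => x; apply/idP/idP => [cx|/orP[]/eqP->//]; last by rewrite e_sym (nbrs2E Nb) eqxx orbT.
    have := nbrs2E Nc b; rewrite [e c b]e_sym (nbrs2E Nb) eqxx orbT => /esym bst.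
    move: cx cd; rewrite !(nbrs2E Nc).
    case/orP: bst => /eqP bE; subst b => /orP[]/eqP-> /orP[]/eqP dE; subst d; rewrite ?eqxx ?orbT //.
      by rewrite eqxx in bd.
    by rewrite eqxx in bd.
  apply: (no_square3 Nb Na Nc') => //.
move=> s t; apply/negP => Nd.
have da : e d a by rewrite e_sym.
have dc : e d c by rewrite e_sym.
have Nd' : nbrs2 d a c.
  apply: nbrs2P => x; apply/idP/idP => [dx|/orP[]/eqP->//].
  move: dx da dc; rewrite !(nbrs2E Nd) => /orP[]/eqP-> /orP[]/eqP aE /orP[]/eqP cE; subst; rewrite ?eqxx ?orbT //.
    by rewrite eqxx in ac.
  by rewrite eqxx in ac.
exact: (no_square3 Na Nb Nd').
Qed.

(** * Exchanges in families of maximal independent sets *)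

Section Families.
Variable k : nat.
Implicit Types (G H : 'I_k -> {set V}).

Definition mult G x := (\sum_(i < k) (x \in G i))%N.

(** Written additively to avoid truncated subtraction. On the complements it multiplies the monomial
    by [x_t] and divides it by [x_y]. *)
Definition exchange G t y := exists H, (forall i, mis (H i)) /\
  forall x, mult H x + (x == t) = mult G x + (x == y).

Lemma exchange1 G i t y : (forall i, mis (G i)) -> t \in G i -> y \notin G i ->
  (forall x, x \in G i -> e y x -> x = t) -> exchange G t y.
Proof.
move=> mG tG yG yP.
exists (fun j => if j == i then y |: G i :\ t else G j); split.
  by move=> j; case: eqP => // _; apply: mis_swap.
move=> x; rewrite /mult (bigD1 i) //= [in RHS](bigD1 i) //= eqxx.
rewrite (eq_bigr (fun j => (x \in G j) : nat)); last by move=> j /negPf ->.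
rewrite addnAC [RHS]addnAC; congr (_ + _); rewrite !inE.
have [->|xy] := eqVneq x y; first by rewrite (negPf yG); case: eqP => // yt; rewrite -yt (negPf yG) in tG.
by have [->|xt] := eqVneq x t; rewrite ?tG ?addn0.
Qed.

(** Two members change at once. The sizes of [A] and [B] add up to those of [G i] and [G j], and
    neither exceeds the common size of maximal independent sets, so both sets are maximal. *)
Lemma exchange2 G i j t y A B : (forall i, mis (G i)) -> i != j -> indep e A -> indep e B ->
  (forall x, (x \in A) + (x \in B) + (x == t) = (x \in G i) + (x \in G j) + (x == y)) ->
  exchange G t y.
Proof.
move=> mG nij iA iB AB.
have cAB : #|A| + #|B| = #|G i| + #|G j|.
  have cs (X : {set V}) : #|X| = \sum_x (x \in X).
    by rewrite -sum1_card big_mkcond; apply: eq_bigr => x _; case: (x \in X).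
  have c1 z : \sum_x (x == z) = 1%N by rewrite -(cards1 z) cs; apply: eq_bigr => x _; rewrite inE.
  apply/eqP; rewrite -(eqn_add2r 1); apply/eqP.
  rewrite -{1}(c1 t) -(c1 y) !cs -!big_split /=; exact: eq_bigr.
have [iGi _] := maxsetP (mG i); have [iGj _] := maxsetP (mG j).
have cij : #|G i| = #|G j| by apply/eqP; rewrite eqn_leq !wc.
have cA := wc (mG i) iA; have cB := wc (mG i) iB.
exists (fun l => if l == i then A else if l == j then B else G l); split.
  move=> l; case: eqP => _; last case: eqP => _ //.
    by apply: (mis_card (mG i)) => //; move: cAB cij cA cB; move: #|A| #|B| #|G i| #|G j|; clear; lia.
  by apply: (mis_card (mG i)) => //; move: cAB cij cA cB; move: #|A| #|B| #|G i| #|G j|; clear; lia.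
have nji : j != i by rewrite eq_sym.
move=> x; rewrite /mult (bigD1 i) //= (bigD1 j nji) /=.
rewrite [\sum_(l < k) (x \in G l)](bigD1 i) //= (bigD1 j nji) /= !eqxx (negPf nji).
rewrite (eq_bigr (fun j => (x \in G j) : nat)); last by move=> l /andP[/negPf-> /negPf->].
by rewrite !addnA [LHS]addnAC [RHS]addnAC AB.
Qed.

(** A maximal independent set meets the clique [N[y]] in exactly one vertex. *)
Lemma simplex_mult G y : simplicial y -> (forall i, mis (G i)) ->
  \sum_(x | (x == y) || e y x) mult G x = k.
Proof.
move=> sy mG; rewrite exchange_big /= -[RHS]card_ord -sum1_card; apply: eq_bigr => i _.
have [z zy zG] : exists2 z, (z == y) || e y z & z \in G i.
  have [yG|yG] := boolP (y \in G i); first by exists y; rewrite ?eqxx.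
  by have [z zG yz] := mis_dom (mG i) yG; exists z; rewrite ?yz ?orbT.
rewrite (bigD1 z) //= zG big1 // => x /andP[xy xz]; apply/eqP; rewrite eqb0; apply/negP => xG.
suff: e x z by rewrite (mis_indep (mG i) xG zG).
move/simplicialP: sy => sy; case/orP: xy => [/eqP xE|yx]; case/orP: zy => [/eqP zE|yz].
- by rewrite xE zE eqxx in xz.
- by rewrite xE.
- by rewrite zE e_sym.
- exact: sy.
Qed.

(** * Families on a basic 5-cycle *)

Section FiveCycle.
Variables (p1 p2 p3 p4 p5 : V).
Hypothesis b5 : basic5 p1 p2 p3 p4 p5.

Definition trace F := [:: p1 \in F; p2 \in F; p3 \in F; p4 \in F; p5 \in F].

(** [p2], [p4] and [p5] have all their neighbours on the cycle, so independence and domination at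
    these three leave only five patterns, each a pair of vertices. *)
Lemma basic5_trace F : mis F -> trace F \in
  [:: [:: true; false; true; false; false]; [:: true; false; false; true; false];
      [:: false; true; false; true; false]; [:: false; false; true; false; true];
      [:: false; true; false; false; true]].
Proof.
move=> mF; case/and4P: b5 => u /nbrs2E N2 /nbrs2E N4 /nbrs2E N5.
have dom x y z : (forall t, e x t = (t == y) || (t == z)) ->
    [|| x \in F, y \in F | z \in F].
  move=> Nx; apply: contraT; rewrite !negb_or => /and3P[xF yF zF].
  have [t tF] := mis_dom mF xF; rewrite Nx => /orP[]/eqP tE; rewrite tE ?(negPf yF) ?(negPf zF) // in tF.
have ind x y z : (forall t, e x t = (t == y) || (t == z)) ->
    (x \in F) && ((y \in F) || (z \in F)) = false.
  move=> Nx; apply/negP => /andP[xF /orP[]] yF.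
    by have := mis_indep mF xF yF; rewrite Nx eqxx.
  by have := mis_indep mF xF yF; rewrite Nx eqxx orbT.
move: (dom _ _ _ N2) (dom _ _ _ N4) (dom _ _ _ N5) (ind _ _ _ N2) (ind _ _ _ N4) (ind _ _ _ N5).
rewrite /trace; do 5 case: (_ \in F) => //.
Qed.

(** By [basic5_trace], for one of the five pairs this counts the members with exactly that trace. *)
Definition tcount G (a b : V) := \sum_(i < k) ((a \in G i) && (b \in G i)).

Lemma basic5_mult G : (forall i, mis (G i)) ->
  [/\ mult G p1 = tcount G p1 p3 + tcount G p1 p4,
      mult G p3 = tcount G p1 p3 + tcount G p3 p5,
      mult G p4 = tcount G p2 p4 + tcount G p1 p4,
      mult G p5 = tcount G p3 p5 + tcount G p2 p5 &
      mult G p2 = tcount G p2 p4 + tcount G p2 p5 /\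
      k = tcount G p1 p3 + tcount G p1 p4 + tcount G p2 p4 + tcount G p3 p5 + tcount G p2 p5].
Proof.
move=> mG; split; [..|split; last rewrite -[LHS]card_ord -sum1_card];
 rewrite /mult /tcount -?big_split /=; apply: eq_bigr => i _;
 by have := basic5_trace (mG i); rewrite /trace !inE;
   do 5 case: (_ \in G i).
Qed.

Lemma tcount_gt0 G a b : 0 < tcount G a b -> exists2 i, a \in G i & b \in G i.
Proof.
rewrite lt0n sum_nat_eq0 negb_forall => /existsP[i]; rewrite /= eqb0 negbK => /andP[].
by exists i.
Qed.

(** Everything that hangs at [p3], together with [p3] itself. *)
Definition branch := [set x | connect (avoid [set p2; p4]) p3 x].

(** A path from [p3] to [p1] avoiding [p2] and [p4] would close up at [p2] to a second cycle through
    the edge [p2 p3], one that misses [p4]. *)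
Lemma branchP : [/\ p3 \in branch, p1 \notin branch, p2 \notin branch, p4 \notin branch &
  p5 \notin branch].
Proof.
case/and4P: (b5) => u N2 N4 N5; have c5 := basic5_cycle b5.
have [N2E N4E N5E] := And3 (nbrs2E N2) (nbrs2E N4) (nbrs2E N5).
rewrite /= !inE !negb_or in u.
case/and5P: u => /and4P[n12 n13 n14 n15] /and3P[n23 n24 n25] /andP[n34 n35] n45 _.
have p3X : p3 \notin [set p2; p4] by rewrite !inE negb_or eq_sym n23.
have p1B : p1 \notin branch.
  rewrite inE; apply/negP => c31.
  have p2X : p2 \in [set p2; p4] by rewrite !inE eqxx.
  have e23 : e p2 p3 by rewrite N2E eqxx orbT.
  have e21 : e p2 p1 by rewrite N2E eqxx.
  have n31 : p3 != p1 by rewrite eq_sym.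
  have [q [cq _ qX]] := path_cycle p2X n31 e23 e21 p3X c31.
  have c5' : is_cycle e [:: p2; p3; p4; p5; p1].
    by case: c5 => _ u5 c5; split; rewrite // -(rot_uniq 4, rot_cycle 4).
  have: p4 \in [:: p2, p3 & q] by apply: (cactus_mem c5' cq); rewrite !inE eqxx !orbT.
  rewrite inE eq_sym (negPf n24) /= => /qX; by rewrite !inE eqxx orbT.
have notX x : x \in [set p2; p4] -> x \notin branch.
  by move=> xX; rewrite inE; apply/negP => /(connect_avoid p3X); rewrite xX.
split=> //; first by rewrite inE connect0.
- by apply: notX; rewrite !inE eqxx.
- by apply: notX; rewrite !inE eqxx orbT.
apply: contra p1B; rewrite !inE => c35; apply: connect_trans c35 _; apply: connect1.
by rewrite /avoid N5E eqxx orbT !inE !negb_or [p5 == _]eq_sym n25 [p5 == _]eq_sym n45 n12 n14.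
Qed.

Lemma branch_edge x y : x \in branch -> y \notin branch -> e x y -> x = p3 /\ (y \in [:: p2; p4]).
Proof.
case/and4P: (b5) => u /nbrs2E N2 /nbrs2E N4 /nbrs2E N5.
have [p3B p1B p2B p4B p5B] := branchP.
move=> xB yB exy.
have xX : x \notin [set p2; p4].
  by apply/negP => /set2P[]xE; move: p2B p4B; rewrite -xE xB.
have: y \in [set p2; p4].
  apply: contraT => yX; move: yB; rewrite inE; move: xB; rewrite inE => xB.
  by rewrite (connect_trans xB) // connect1 // /avoid exy xX.
rewrite !inE => yE; split=> //; case/orP: yE exy => /eqP->; rewrite e_sym ?N2 ?N4 => /orP[]/eqP //.
  by move=> xE; rewrite -xE xB in p1B.
by move=> xE; rewrite -xE xB in p5B.
Qed.

(** The branch is joined to the rest only through [p2] and [p4]: the first is kept out by [p1], the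
    second is deleted. *)
Lemma branch_swapl F F' : indep e F -> indep e F' -> p1 \in F ->
  indep e ((F :\: branch) :\ p4 :|: (F' :&: branch)).
Proof.
move=> /indepP iF /indepP iF' p1F.
case/and4P: (b5) => u /nbrs2E N2 _ _.
have cross x y : x \in (F :\: branch) :\ p4 -> y \in F' :&: branch -> e x y = false.
  rewrite in_setD1 in_setD in_setI => /and3P[x4 xB xF] /andP[yF' yB].
  apply/negP; rewrite e_sym => /(branch_edge yB xB)[_]; rewrite !inE (negPf x4) orbF => /eqP xE.
  by have := iF x p1 xF p1F; rewrite xE N2 eqxx.
apply/indepP => x y /setUP[xF|xF] /setUP[yF|yF].
- by move: xF yF => /setD1P[_ /setDP[xF _]] /setD1P[_ /setDP[yF _]]; apply: iF.
- exact: cross.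
- by rewrite e_sym cross.
- by move: xF yF => /setIP[xF _] /setIP[yF _]; apply: iF'.
Qed.

Lemma branch_swapr F F' : indep e F -> indep e F' -> p3 \notin F ->
  indep e ((F' :\: branch) :|: (F :&: branch)).
Proof.
move=> /indepP iF /indepP iF' p3F.
have cross x y : x \in F' :\: branch -> y \in F :&: branch -> e x y = false.
  rewrite in_setD in_setI => /andP[xB xF'] /andP[yF yB].
  apply/negP; rewrite e_sym => /(branch_edge yB xB)[yE _].
  by rewrite -yE yF in p3F.
apply/indepP => x y /setUP[xF|xF] /setUP[yF|yF].
- by move: xF yF => /setDP[xF _] /setDP[yF _]; apply: iF'.
- exact: cross.
- by rewrite e_sym cross.
- by move: xF yF => /setIP[xF _] /setIP[yF _]; apply: iF.
Qed.

(** The traces are [p1 p4] and [p3 p5]. Swapping the branches and dropping [p4] leaves [p1 p3] and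
    [p5]; the second is completed to [p2 p5] for the first exchange and changed to [p2 p4] for the
    second. *)
Lemma basic5_exchange G i j : (forall i, mis (G i)) ->
  p1 \in G i -> p4 \in G i -> p3 \in G j -> p5 \in G j ->
  exchange G p4 p2 /\ exchange G p5 p2.
Proof.
move=> mG p1i p4i p3j p5j.
have ti := basic5_trace (mG i); have tj := basic5_trace (mG j).
rewrite /trace p1i p4i !inE /= in ti; rewrite /trace p3j p5j !inE /= in tj.
have [p2i p3i p5i] : [/\ p2 \notin G i, p3 \notin G i & p5 \notin G i].
  by move: ti; do 3 case: (_ \in G i).
have [p1j p2j p4j] : [/\ p1 \notin G j, p2 \notin G j & p4 \notin G j].
  by move: tj; do 3 case: (_ \in G j).
have nij : i != j by apply: contraNneq p5i => ->.
have [iGi _] := maxsetP (mG i); have [iGj _] := maxsetP (mG j).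
have iA := branch_swapl iGi iGj p1i.
have iB := branch_swapr iGi iGj p3i.
have [p3B p1B p2B p4B p5B] := branchP.
case/and4P: (b5) => u /nbrs2E N2 /nbrs2E N4 /nbrs2E N5.
rewrite /= !inE !negb_or in u.
case/and5P: u => /and4P[n12 n13 n14 n15] /and3P[n23 n24 n25] /andP[n34 n35] n45 _.
have iB2 : indep e (p2 |: ((G j :\: branch) :|: (G i :&: branch))).
  apply: indepU1 => // t; rewrite in_setU in_setD in_setI N2 => tB.
  apply/negP => /orP[]/eqP tE; move: tB; rewrite tE.
    by rewrite (negPf p1j) (negPf p1B) !andbF.
  by rewrite (negPf p3i) p3B.
split.
  apply: (exchange2 mG nij iA iB2) => x.
  rewrite in_setU in_setD1 in_setD in_setI in_setU1 in_setU in_setD in_setI.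
  have [xB|xB] := boolP (x \in branch).
    have -> : (x == p4) = false by apply: contraNF p4B => /eqP <-.
    have -> : (x == p2) = false by apply: contraNF p2B => /eqP <-.
    by rewrite /= !andbT !addn0 addnC.
  rewrite /= !andbF !orbF.
  have [->|x4] := eqVneq x p4; first by rewrite p4i (negPf p4j) eq_sym (negPf n24).
  have [->|x2] := eqVneq x p2; first by rewrite (negPf p2i) (negPf p2j).
  by rewrite !addn0.
have iB3 : indep e (p4 |: (p2 |: ((G j :\: branch) :|: (G i :&: branch))) :\ p5).
  apply: indep_swap => // t; rewrite in_setU1 in_setU in_setD in_setI N4 => tB.
  case/orP => /eqP // tE; move: tB; rewrite tE eq_sym (negPf n23).
  by rewrite p3B (negPf p3i).
apply: (exchange2 mG nij iA iB3) => x.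
rewrite in_setU in_setD1 in_setD in_setI in_setU1 in_setD1 in_setU1 in_setU in_setD in_setI.
have [xB|xB] := boolP (x \in branch).
  have -> : (x == p4) = false by apply: contraNF p4B => /eqP <-.
  have -> : (x == p2) = false by apply: contraNF p2B => /eqP <-.
  have -> : (x == p5) = false by apply: contraNF p5B => /eqP <-.
  by rewrite /= !andbT !addn0 addnC.
rewrite /= !andbF !orbF.
have [->|x4] := eqVneq x p4; first by rewrite p4i (negPf p4j) [p4 == p2]eq_sym (negPf n24) (negPf n45).
have [->|x2] := eqVneq x p2; first by rewrite (negPf p2i) (negPf p2j) (negPf n25).
have [->|x5] := eqVneq x p5; first by rewrite (negPf p5i) p5j.
by rewrite !addn0.
Qed.

(** In a member with trace [p2 p4], [p4] can move to [p5]. Without one, the surplus at [p4] lies in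
    [p1 p4]; equal counts at [p1] then mean fewer traces [p1 p3], and equal counts at [p3] more
    traces [p3 p5]. *)
Lemma basic5_first G H : (forall i, mis (G i)) -> (forall i, mis (H i)) ->
  mult G p1 = mult H p1 -> mult G p3 = mult H p3 -> mult G p4 < mult H p4 ->
  exchange H p4 p5 \/ exchange H p4 p2.
Proof.
move=> mG mH m1 m3 m4.
have [g1 g3 g4 g5 [g2 gk]] := basic5_mult mG; have [h1 h3 h4 h5 [h2 hk]] := basic5_mult mH.
case: (posnP (tcount H p2 p4)) => [h24|/tcount_gt0[i p2i p4i]]; last first.
  left; have ti := basic5_trace (mH i); rewrite /trace p2i p4i !inE in ti.
  have [p1i p5i] : p1 \notin H i /\ p5 \notin H i by move: ti; do 3 case: (_ \in H i).
  apply: (exchange1 mH p4i p5i) => x xi; case/and4P: b5 => _ _ _ /nbrs2E -> /orP[]/eqP // xE.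
  by rewrite -xE xi in p1i.
right.
have h14 : 0 < tcount H p1 p4 by move: m1 m3 m4 g1 g3 g4 h1 h3 h4 h24; clear; lia.
have h35 : 0 < tcount H p3 p5 by move: m1 m3 m4 g1 g3 g4 h1 h3 h4 h24; clear; lia.
have [i p1i p4i] := tcount_gt0 h14; have [j p3j p5j] := tcount_gt0 h35.
by have [] := basic5_exchange mH p1i p4i p3j p5j.
Qed.

(** The number of traces [p2 p5] is [k] minus the counts at [p3] and [p4], so the surplus at [p5]
    lies in [p3 p5]. This means fewer traces [p1 p3] and more traces [p1 p4]. *)
Lemma basic5_second G H : (forall i, mis (G i)) -> (forall i, mis (H i)) ->
  mult G p1 = mult H p1 -> mult G p3 = mult H p3 -> mult G p4 = mult H p4 ->
  mult G p5 < mult H p5 -> exchange H p5 p2.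
Proof.
move=> mG mH m1 m3 m4 m5.
have [g1 g3 g4 g5 [g2 gk]] := basic5_mult mG; have [h1 h3 h4 h5 [h2 hk]] := basic5_mult mH.
have h14 : 0 < tcount H p1 p4 by move: m1 m3 m4 m5 g1 g3 g4 g5 gk h1 h3 h4 h5 hk; clear; lia.
have h35 : 0 < tcount H p3 p5 by move: m1 m3 m4 m5 g1 g3 g4 g5 gk h1 h3 h4 h5 hk; clear; lia.
have [i p1i p4i] := tcount_gt0 h14; have [j p3j p5j] := tcount_gt0 h35.
by have [] := basic5_exchange mH p1i p4i p3j p5j.
Qed.

Lemma basic5_last G H : (forall i, mis (G i)) -> (forall i, mis (H i)) ->
  mult G p1 = mult H p1 -> mult G p3 = mult H p3 -> mult G p4 = mult H p4 ->
  mult G p5 = mult H p5 -> mult G p2 = mult H p2.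
Proof.
move=> mG mH m1 m3 m4 m5.
have [g1 g3 g4 g5 [g2 gk]] := basic5_mult mG; have [h1 h3 h4 h5 [h2 hk]] := basic5_mult mH.
by move: m1 m3 m4 m5 g1 g2 g3 g4 g5 gk h1 h2 h3 h4 h5 hk; clear; lia.
Qed.

End FiveCycle.
End Families.

(** * The ordering of the vertices *)

Definition five : finType := (V * V * V * V * V)%type.
Definition basic (p : five) := let: (p1, p2, p3, p4, p5) := p in basic5 p1 p2 p3 p4 p5.
Definition verts (p : five) := let: (p1, p2, p3, p4, p5) := p in [:: p1; p2; p3; p4; p5].
Definition apex (p : five) : V := let: (p1, p2, p3, p4, p5) := p in p2.
Definition base (p : five) : seq V := let: (p1, p2, p3, p4, p5) := p in [:: p4; p5].

(* The labelling of a basic 5-cycle is not unique when fewer than two of its vertices have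
   degree at least 3, so one labelling is selected for each vertex set. *)
Definition canon (p : five) :=
  basic p && ([pick q | basic q && ([set x in verts q] == [set x in verts p])] == Some p).

Lemma canon_exists v : in_basic5 v -> exists2 p, canon p & v \in verts p.
Proof.
case/in_basic5E => p1 [p2 [p3 [p4 [p5 [b vp]]]]].
pose p : five := (p1, p2, p3, p4, p5).
pose Q q := basic q && ([set x in verts q] == [set x in verts p]).
have [q pE] : exists q, pick Q = Some q.
  by case: pickP => [q _|/(_ p)]; [exists q|rewrite /Q /= b eqxx].
have /andP[bq /eqP qE] : Q q by move: pE; case: pickP => // q' Qq' [<-].
exists q; last by have /setP/(_ v) := qE; rewrite inE => ->; rewrite inE.
by rewrite /canon bq qE; apply/eqP.
Qed.

Lemma basic5_nonadj13 p1 p2 p3 p4 p5 : basic5 p1 p2 p3 p4 p5 -> e p1 p3 = false.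
Proof.
move=> b; have c5 := basic5_cycle b; case/and4P: b => u /nbrs2E N2 _ _.
apply/negP => e13; rewrite /= !inE !negb_or in u.
case/and5P: u => /and4P[n12 n13 n14 n15] /and3P[n23 n24 n25] /andP[n34 n35] n45 _.
have c3 : is_cycle e [:: p1; p2; p3].
  split; rewrite //= ?inE ?negb_or ?n12 ?n13 ?n23 //.
  by rewrite [e p1 p2]e_sym !N2 !eqxx orbT [e p3 p1]e_sym e13.
have: p4 \in [:: p1; p2; p3] by apply: (cactus_mem c5 c3); rewrite !inE eqxx !orbT.
by rewrite !inE ![p4 == _]eq_sym (negPf n14) (negPf n24) (negPf n34).
Qed.

Lemma basic5_not_simplicial p1 p2 p3 p4 p5 x : basic5 p1 p2 p3 p4 p5 ->
  x \in [:: p1; p2; p3; p4; p5] -> ~~ simplicial x.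
Proof.
move=> b; have e13 := basic5_nonadj13 b.
case/and4P: b => u /nbrs2E N2 /nbrs2E N4 /nbrs2E N5; rewrite /= !inE !negb_or in u.
case/and5P: u => /and4P[n12 n13 n14 n15] /and3P[n23 n24 n25] /andP[n34 n35] n45 _.
have ns y a b : e y a -> e y b -> a != b -> e a b = false -> ~~ simplicial y.
  by move=> ya yb ab eab; apply/negP => /simplicialP/(_ a b ya yb ab); rewrite eab.
rewrite !inE => /orP[|/or4P[]] /eqP->.
- apply: (ns _ p2 p5); rewrite // ?[e p1 _]e_sym ?N2 ?N5 ?eqxx ?orbT //.
  by rewrite ![p5 == _]eq_sym (negPf n15) (negPf n35).
- by apply: (ns _ p1 p3); rewrite // N2 eqxx ?orbT.
- apply: (ns _ p2 p4); rewrite // ?[e p3 _]e_sym ?N2 ?N4 ?eqxx ?orbT //.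
  by rewrite ![p4 == _]eq_sym (negPf n14) (negPf n34).
- apply: (ns _ p3 p5); rewrite // ?N4 ?eqxx ?orbT //.
  by rewrite e_sym N5 (negPf n34) eq_sym (negPf n13).
- apply: (ns _ p4 p1); rewrite // ?N5 ?eqxx ?orbT // 1?eq_sym //.
  by rewrite N4 (negPf n13) (negPf n15).
Qed.

Lemma basic5_free_edges p1 p2 p3 p4 p5 x y : basic5 p1 p2 p3 p4 p5 ->
  x \in [:: p2; p4; p5] -> e x y ->
  y \in [:: p1; p2; p3; p4; p5] /\ [set x; y] \in cycle_edges [:: p1; p2; p3; p4; p5].
Proof.
case/and4P => u /nbrs2E N2 /nbrs2E N4 /nbrs2E N5; rewrite /= !inE !negb_or in u.
case/and5P: u => /and4P[n12 n13 n14 n15] /and3P[n23 n24 n25] /andP[n34 n35] n45 _.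
have ed z w : next [:: p1; p2; p3; p4; p5] z = w -> z \in [:: p1; p2; p3; p4; p5] ->
    [set z; w] \in cycle_edges [:: p1; p2; p3; p4; p5].
  by move=> <- zp; apply: imset_f.
have n1 : next [:: p1; p2; p3; p4; p5] p1 = p2 by rewrite /= eqxx.
have n2 : next [:: p1; p2; p3; p4; p5] p2 = p3 by rewrite /= eq_sym (negPf n12) eqxx.
have n3 : next [:: p1; p2; p3; p4; p5] p3 = p4.
  by rewrite /= ![p3 == _]eq_sym (negPf n13) (negPf n23) eqxx.
have n4 : next [:: p1; p2; p3; p4; p5] p4 = p5.
  by rewrite /= ![p4 == _]eq_sym (negPf n14) (negPf n24) (negPf n34) eqxx.
have n5 : next [:: p1; p2; p3; p4; p5] p5 = p1.
  by rewrite /= ![p5 == _]eq_sym (negPf n15) (negPf n25) (negPf n35) (negPf n45) eqxx.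
rewrite !inE => /or3P[]/eqP->.
- rewrite N2 => /orP[]/eqP->; rewrite eqxx ?orbT; split=> //.
    by rewrite setUC (ed _ _ n1) // !inE eqxx.
  by rewrite (ed _ _ n2) // !inE eqxx !orbT.
- rewrite N4 => /orP[]/eqP->; rewrite eqxx ?orbT; split=> //.
    by rewrite setUC (ed _ _ n3) // !inE eqxx !orbT.
  by rewrite (ed _ _ n4) // !inE eqxx !orbT.
- rewrite N5 => /orP[]/eqP->; rewrite eqxx ?orbT; split=> //.
    by rewrite setUC (ed _ _ n4) // !inE eqxx !orbT.
  by rewrite (ed _ _ n5) // !inE eqxx !orbT.
Qed.

Lemma basic5_free_not_simplex p1 p2 p3 p4 p5 x : basic5 p1 p2 p3 p4 p5 ->
  x \in [:: p2; p4; p5] -> ~~ in_simplex x.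
Proof.
move=> b xp; apply/negP => /existsP[y /andP[sy xy]].
suff yp : y \in [:: p1; p2; p3; p4; p5] by rewrite (negPf (basic5_not_simplicial b yp)) in sy.
case/orP: xy => [/eqP <-|yx]; last by have [] := basic5_free_edges b xp (etrans (e_sym x y) yx).
by move: xp; rewrite !inE => /or3P[]->; rewrite ?orbT.
Qed.

Lemma basic_cycle p : basic p -> is_cycle e (verts p).
Proof. by case: p => [[[[p1 p2] p3] p4] p5]; apply: basic5_cycle. Qed.

(** [x] has degree 2 with both edges on the cycle of [q], so the two cycles share an edge and hence
    their vertices; [canon] then fixes the labelling. *)
Lemma canon_inj p q x : canon p -> canon q -> x \in apex q :: base q -> x \in verts p -> p = q.
Proof.
move=> /andP[bp /eqP pE] /andP[bq /eqP qE] xq xp.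
have cp := basic_cycle bp; have cq := basic_cycle bq.
have exn : e x (next (verts p) x) by apply: next_cycle xp; case: cp.
have edq : [set x; next (verts p) x] \in cycle_edges (verts q).
  case: (q) bq xq => [[[[q1 q2] q3] q4] q5] /= bq xq.
  by case: (basic5_free_edges bq xq exn).
have edp : [set x; next (verts p) x] \in cycle_edges (verts p) by apply: imset_f.
have E := cactusE cp cq exn edp edq.
suff vE : [set x in verts q] = [set x in verts p] by move: qE; rewrite vE pE => -[].
apply/setP => z; rewrite !inE; apply/idP/idP => zc.
  have: [set z; next (verts q) z] \in cycle_edges (verts q) by apply: imset_f.
  by rewrite -E => /cycle_edgesP[].
have: [set z; next (verts p) z] \in cycle_edges (verts p) by apply: imset_f.
by rewrite E => /cycle_edgesP[].
Qed.

Definition is_apex x := [exists p, canon p && (x == apex p)].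
Definition is_base x := [exists p, canon p && (x \in base p)].

(** Higher levels come later in the ordering; ties are broken arbitrarily. *)
Definition level x : nat :=
  if simplicial x || is_apex x then 2 else if ~~ covered x || is_base x then 1 else 0.

Lemma apex_nbrs2 x : is_apex x || is_base x -> exists s t, nbrs2 x s t.
Proof.
case/orP=> /existsP[[[[[p1 p2] p3] p4] p5]] /andP[/andP[/= /and4P[_ N2 N4 N5] _]] /=.
  by move/eqP->; exists p1, p3.
by rewrite !inE => /orP[]/eqP->; [exists p3, p5|exists p4, p1].
Qed.

Lemma simplex_not_apex x : in_simplex x -> is_apex x = false.
Proof.
move=> xA; apply/negbTE/negP => /existsP[[[[[p1 p2] p3] p4] p5]] /andP[/andP[/= b _]] /eqP xE.
by have := @basic5_free_not_simplex _ _ _ _ _ x b; rewrite xE !inE eqxx -xE xA => /(_ isT).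
Qed.

(** By [canon_inj] no other selected cycle makes one of these vertices an apex or a base vertex. *)
Lemma level_canon p1 p2 p3 p4 p5 : canon (p1, p2, p3, p4, p5) ->
  [/\ level p1 = 0, level p3 = 0, level p4 = 1, level p5 = 1 & level p2 = 2].
Proof.
set p := (p1, p2, p3, p4, p5) => cp; have b : basic5 p1 p2 p3 p4 p5 by case/andP: cp.
have ns x : x \in [:: p1; p2; p3; p4; p5] -> simplicial x = false.
  by move=> xp; apply/negbTE; apply: basic5_not_simplicial xp.
have cov x : x \in [:: p1; p2; p3; p4; p5] -> covered x.
  by move=> xp; rewrite /covered (in_basic5I b xp) orbT.
have apexE x : x \in [:: p1; p2; p3; p4; p5] -> is_apex x = (x == p2).
  move=> xp; apply/existsP/eqP => [[q /andP[cq /eqP xq]]|->]; last by exists p; rewrite cp /=.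
  have pq : p = q by apply: (@canon_inj p q x) => //; rewrite xq mem_head.
  by rewrite xq -pq.
have baseE x : x \in [:: p1; p2; p3; p4; p5] -> is_base x = (x \in [:: p4; p5]).
  move=> xp; apply/existsP/idP => [[q /andP[cq xq]]|xb]; last by exists p; rewrite cp.
  have pq : p = q by apply: (@canon_inj p q x) => //; rewrite inE xq orbT.
  by rewrite -pq in xq.
case/and4P: b => u _ _ _; rewrite /= !inE !negb_or in u.
case/and5P: u => /and4P[n12 n13 n14 n15] /and3P[n23 n24 n25] /andP[n34 n35] n45 _.
have lvl x : x \in [:: p1; p2; p3; p4; p5] ->
    level x = if x == p2 then 2 else if x \in [:: p4; p5] then 1 else 0.
  by move=> xp; rewrite /level ns // apexE // cov // baseE.
rewrite !lvl ?inE ?eqxx ?orbT //.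
rewrite (negPf n12) (negPf n14) (negPf n15) [p3 == p2]eq_sym (negPf n23) (negPf n34) (negPf n35).
by rewrite [p4 == p2]eq_sym (negPf n24) [p5 == p2]eq_sym (negPf n25).
Qed.

(** * The exchange at the first vertex where two families differ *)

Section Exchange.
Variables (k : nat) (rk : V -> nat).
Hypothesis rk_inj : injective rk.
Hypothesis rk_level : forall x y, level x < level y -> rk x < rk y.
Variables (G H : 'I_k -> {set V}).
Hypothesis (mG : forall i, mis (G i)) (mH : forall i, mis (H i)).
Variable t : V.
Hypothesis eq_before : forall x, rk x < rk t -> mult G x = mult H x.
Hypothesis lt_t : mult G t < mult H t.

(** A larger multiplicity is a smaller exponent of the complements, so [G] and [H] stand for [u] and
    [v] in the weakly polymatroidal condition. *)
Let goal := exists y, rk t < rk y /\ exchange H t y.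

Lemma some_mem : exists i, t \in H i.
Proof.
have: 0 < mult H t by apply: leq_ltn_trans lt_t.
rewrite lt0n sum_nat_eq0 negb_forall => /existsP[i]; rewrite /= eqb0 negbK => ti.
by exists i.
Qed.

(** A simplicial vertex of the clique after [t] can replace [t]. Without one, [t] is the last vertex
    of the clique, and the constant total [k] over the clique forces equal multiplicities at [t]. *)
Lemma exchange_simplex : in_simplex t -> goal.
Proof.
move=> tA; have /existsP[y /andP[sy ty]] := tA.
have [i ti] := some_mem.
have [y' /and3P[sy' yy' lt']|none] :=
  pickP (fun y' => [&& simplicial y', (y' == y) || e y y' & rk t < rk y']).
  have y't : e y' t.
    have nyt : y' != t by apply: contraTneq lt' => ->; rewrite ltnn.
    case/orP: yy' => [/eqP yE|yy'].
      by case/orP: ty; rewrite -yE // eq_sym (negPf nyt).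
    case/orP: ty => [/eqP->|yt]; first by rewrite e_sym.
    by move/simplicialP: sy => /(_ y' t yy' yt nyt).
  have [iH _] := maxsetP (mH i); have [y'H y'P] := simplex_swap sy' y't iH ti.
  by exists y'; split=> //; apply: exchange1 ti y'H y'P.
exfalso.
(* Otherwise [t] has level below 2, as it is no apex either, and the simplicial vertex [y] comes
   after it. *)
have st : simplicial t.
  apply: contraT => nst; have := none y; rewrite sy eqxx /= => /negP; case.
  apply: rk_level; rewrite {2}/level sy /= /level (negPf nst) simplex_not_apex //=.
  by case: ifP.
have before x : (x == y) || e y x -> x != t -> rk x < rk t.
  move=> xy xt; have [sx|nsx] := boolP (simplicial x).
    have := none x; rewrite sx xy /= ltnNge => /negbFE; rewrite leq_eqVlt => /orP[/eqP/rk_inj xE|//].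
    by rewrite xE eqxx in xt.
  apply: rk_level; rewrite {2}/level st /= /level (negPf nsx) simplex_not_apex //=; first by case: ifP.
  by apply/existsP; exists y; rewrite sy.
have := etrans (simplex_mult sy mG) (esym (simplex_mult sy mH)).
rewrite (bigD1 t) //= [in RHS](bigD1 t) //=.
rewrite (eq_bigr (mult H)); last by move=> x /andP[xy xt]; apply/eq_before/before.
by move/eqP; rewrite eqn_add2r => /eqP E; move: lt_t; rewrite E ltnn.
Qed.

(** [p1] and [p3] can be traded for a later neighbour on the cycle, and [p2] comes last, its
    multiplicity being determined by the others. The earlier of [p4] and [p5] uses [basic5_first],
    the later one [basic5_second]; reversing the cycle gives the mirror cases. *)
Lemma exchange_basic5 : in_basic5 t -> goal.
Proof.
case/canon_exists => [[[[[p1 p2] p3] p4] p5]] cp tp.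
have b : basic5 p1 p2 p3 p4 p5 by case/andP: cp.
have br := basic5_rev b.
have [l1 l3 l4 l5 l2] := level_canon cp.
have r14 : rk p1 < rk p4 by apply: rk_level; rewrite l1 l4.
have r15 : rk p1 < rk p5 by apply: rk_level; rewrite l1 l5.
have r12 : rk p1 < rk p2 by apply: rk_level; rewrite l1 l2.
have r34 : rk p3 < rk p4 by apply: rk_level; rewrite l3 l4.
have r35 : rk p3 < rk p5 by apply: rk_level; rewrite l3 l5.
have r32 : rk p3 < rk p2 by apply: rk_level; rewrite l3 l2.
have r42 : rk p4 < rk p2 by apply: rk_level; rewrite l4 l2.
have r52 : rk p5 < rk p2 by apply: rk_level; rewrite l5 l2.
have [i ti] := some_mem; have [iH _] := maxsetP (mH i).
have n45 : p4 != p5.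
  by case/and4P: b => u _ _ _; move: u; rewrite /= !inE !negb_or => /and5P[_ _ _ ->].
move: tp eq_before lt_t ti; rewrite /goal /= !inE => /orP[|/or4P[]] /eqP-> eqb ltt ti.
- have [y [yp yH yP]] := basic5_swap b iH ti; exists y; split; last exact: exchange1 ti yH yP.
  by move: yp; rewrite !inE => /orP[]/eqP->.
- exfalso; move: ltt; rewrite (basic5_last b mG mH) ?ltnn ?eqb //.
- have [y [yp yH yP]] := basic5_swap br iH ti; exists y; split; last exact: exchange1 ti yH yP.
  by move: yp; rewrite !inE => /orP[]/eqP->.
- have [lt45|le54] := ltnP (rk p4) (rk p5).
    by have [] := basic5_first b mG mH (eqb _ r14) (eqb _ r34) ltt; [exists p5|exists p2].
  have lt54 : rk p5 < rk p4.
    rewrite ltn_neqAle le54 andbT; apply: contra n45 => /eqP/rk_inj ->; exact: eqxx.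
  by exists p2; split=> //; apply: (basic5_second br mG mH) => //; apply: eqb.
- have [lt54|le45] := ltnP (rk p5) (rk p4).
    by have [] := basic5_first br mG mH (eqb _ r35) (eqb _ r15) ltt; [exists p4|exists p2].
  have lt45 : rk p4 < rk p5.
    by rewrite ltn_neqAle le45 andbT; apply: contra n45 => /eqP/rk_inj ->.
  by exists p2; split=> //; apply: (basic5_second b mG mH) => //; apply: eqb.
Qed.

(** If [b] comes after [t], it replaces [t] in a member of [H] that omits [c]. If it comes before,
    the multiplicities at [t] agree, because every maximal independent set contains exactly one of
    [t] and [b]. *)
Lemma exchange_uncovered : ~~ covered t -> goal.
Proof.
move=> tU; have [b [c [d [[Na Nb cd] [ac bd Nc Nd]]]]] := uncovered_pair tU.
have lt1 : 0 < level t by rewrite /level tU /=; case: ifP.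
have ebd : e b d = false.
  rewrite (nbrs2E Nb); apply/negbTE; rewrite negb_or [d == t]eq_sym [d == c]eq_sym !edge_neq //.
  by rewrite (nbrs2E Na) eqxx orbT.
have cb : e c b by rewrite e_sym (nbrs2E Nb) eqxx orbT.
have lc : level c = 0.
  have ns : simplicial c = false by apply/negP => /simplicialP/(_ b d cb cd bd); rewrite ebd.
  have cc : covered c.
    apply: contraT => /uncovered_nbrs2 [s [s' [Ns _ _]]].
    by have := Nc s s'; rewrite Ns.
  have : ~~ (is_apex c || is_base c).
    by apply/negP => /apex_nbrs2[s [s' Ns]]; have := Nc s s'; rewrite Ns.
  by rewrite /level ns cc negb_or => /andP[/negPf-> /negPf->].
have ct : rk c < rk t by apply: rk_level; rewrite lc.
have [tb|] := ltnP (rk t) (rk b).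
  have [i /andP[ti ci]|all_c] := pickP (fun i => (t \in H i) && (c \notin H i)).
    have [iH _] := maxsetP (mH i).
    exists b; split=> //; apply: (exchange1 mH ti).
      by apply/negP => bi; have := mis_indep (mH i) bi ti; rewrite (nbrs2E Nb) eqxx.
    move=> x xi; rewrite (nbrs2E Nb) => /orP[]/eqP // xE.
    by rewrite -xE xi in ci.
  (* If every member of [H] with [t] contains [c], the counts are compared through the earlier
     vertex [c]: a maximal independent set with [c] omits [b] and [d], hence contains [t]. *)
  exfalso.
  have H1 : mult H t <= mult H c.
    apply: leq_sum => i _; have := all_c i.
    by case: (t \in H i) => //=; case: (c \in H i).
  have H2 : mult G c <= mult G t.
    apply: leq_sum => i _; have [ci|//] := boolP (c \in G i).
    have [//|ti] := boolP (t \in G i).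
    have [x xi] := mis_dom (mG i) ti; rewrite (nbrs2E Na) => /orP[]/eqP xE; rewrite xE in xi.
      by rewrite (mis_indep (mG i) ci xi) in cb.
    by rewrite (mis_indep (mG i) ci xi) in cd.
  by move: lt_t; rewrite ltnNge (leq_trans H1) // -(eq_before ct).
rewrite leq_eqVlt => /orP[/eqP/rk_inj bt|bt].
  by move: (nbrs2E Na t); rewrite eirr -bt eqxx.
exfalso.
have sumk (F : 'I_k -> {set V}) : (forall i, mis (F i)) -> mult F t + mult F b = k.
  move=> mF; rewrite /mult -big_split /= -[RHS]card_ord -sum1_card; apply: eq_bigr => i _.
  have [ti|ti] := boolP (t \in F i).
    have [bi|//] := boolP (b \in F i).
    by have := mis_indep (mF i) bi ti; rewrite (nbrs2E Nb) eqxx.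
  have [//|bi] := boolP (b \in F i).
  have [x xi] := mis_dom (mF i) ti; rewrite (nbrs2E Na) => /orP[]/eqP xE; rewrite xE in xi.
    by rewrite xi in bi.
  have [y yi] := mis_dom (mF i) bi; rewrite (nbrs2E Nb) => /orP[]/eqP yE; rewrite yE in yi.
    by rewrite yi in ti.
  by rewrite (mis_indep (mF i) yi xi) in cd.
have := etrans (sumk G mG) (esym (sumk H mH)); rewrite (eq_before bt) => /eqP.
by rewrite eqn_add2r => /eqP E; move: lt_t; rewrite E ltnn.
Qed.

Lemma exchange_exists : goal.
Proof.
have [/orP[]|] := boolP (covered t).
- exact: exchange_simplex.
- exact: exchange_basic5.
- exact: exchange_uncovered.
Qed.

End Exchange.

End Graph.

(** * The cycles of length 4 and 7 *)

Section ExcludedCycles.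
Variables (K : fieldType) (n : nat) (e : rel 'I_n).
Hypothesis eirr : irreflexive e.
Hypothesis e_sym : ssrbool.symmetric e.
Hypothesis e_conn : forall x y, connect e x y.
Hypothesis CM : cohen_macaulay (@edge_ideal K n e).
Local Notation V := 'I_n.
Local Notation nbrs2 := (nbrs2 e).
Local Open Scope ring_scope.

Lemma connected_closed (X : {pred V}) a : a \in X ->
  (forall x y, x \in X -> e x y -> y \in X) -> forall x, x \in X.
Proof.
move=> aX Xcl x; have /connectP[p] := e_conn a x.
elim: p a aX => [|y p IHp] a aX /=; first by move=> _ ->.
by case/andP => ay; apply: IHp; apply: Xcl ay.
Qed.

(** The independence complex of the 4-cycle consists of the disjoint edges [a c] and [b d], so the
    indicator of the first contradicts [cm_connected]. *)
Lemma cm_not_C4 a b c d : nbrs2 a b d -> nbrs2 b a c -> nbrs2 c b d -> nbrs2 d a c ->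
  a != c -> b != d -> False.
Proof.
move=> Na Nb Nc Nd ac bd.
have [[[Ea Eb] Ec] Ed] := (nbrs2E Na, nbrs2E Nb, nbrs2E Nc, nbrs2E Nd).
have ab : a != b by apply: (edge_neq eirr); rewrite Ea eqxx.
have ad : a != d by apply: (edge_neq eirr); rewrite Ea eqxx orbT.
have bc : b != c by apply: (edge_neq eirr); rewrite Eb eqxx orbT.
have cd : c != d by apply: (edge_neq eirr); rewrite Ec eqxx orbT.
have allV x : x \in [:: a; b; c; d].
  apply: (connected_closed (a := a)); first by rewrite mem_head.
  move=> y z; rewrite !inE => /or4P[]/eqP->; rewrite ?Ea ?Eb ?Ec ?Ed => /orP[]->; rewrite ?orbT //.
have eac : e a c = false by rewrite Ea [c == b]eq_sym (negPf bc) (negPf cd).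
have iF := indep2 eirr e_sym eac.
have cF : (1 < #|[set a; c]|)%N by rewrite cards2 ac.
pose f x : K := ((x == a) || (x == c))%:R.
have /(_ a b) : forall i j, f i = f j.
  apply: (cm_connected CM iF cF) => i j nij eij; rewrite /f.
  move: (allV i) (allV j) nij eij; rewrite !inE.
  move=> /or4P[]/eqP-> /or4P[]/eqP->; rewrite ?eqxx ?Ea ?Eb ?Ec ?Ed ?eqxx ?orbT //.
    by rewrite [b == a]eq_sym [d == a]eq_sym (negPf ab) (negPf ad) (negPf bc) [d == c]eq_sym (negPf cd).
  by rewrite [b == a]eq_sym [d == a]eq_sym (negPf ab) (negPf ad) (negPf bc) [d == c]eq_sym (negPf cd).
rewrite /f eqxx [b == a]eq_sym (negPf ab) (negPf bc) /= => /eqP.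
by rewrite oner_eq0.
Qed.

Definition adj7 (i j : nat) := (j == i.+1 %% 7)%N || (i == j.+1 %% 7)%N.

(* In the cyclic order [a0 a2 a4 a6 a1 a3 a5] the independence complex of the 7-cycle is a strip
   around a circle; [wind7] counts the crossings of the cut between [a5] and [a0]. *)
Definition wind7 (i j : nat) : int :=
  ((i, j) \in [:: (5, 0); (3, 0); (5, 2)]%N)%:Z - ((j, i) \in [:: (5, 0); (3, 0); (5, 2)]%N)%:Z.

Lemma wind7_cocycle i j k : (i < 7)%N -> (j < 7)%N -> (k < 7)%N ->
  ~~ adj7 i j -> ~~ adj7 j k -> ~~ adj7 i k -> wind7 j k - wind7 i k + wind7 i j = 0.
Proof.
move=> lti ltj ltk nij njk nik; apply/eqP; move: nij njk nik.
by case: i lti => [|[|[|[|[|[|[|?]]]]]]] // _; case: j ltj => [|[|[|[|[|[|[|?]]]]]]] // _;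
   case: k ltk => [|[|[|[|[|[|[|?]]]]]]].
Qed.

(** If [wind7] were a coboundary, its total along the closed loop 0, 2, 4, 6, 1, 3, 5, 0 of
    non-adjacent vertices would vanish, but it is 1. *)
Lemma cm_not_C7 a0 a1 a2 a3 a4 a5 a6 : uniq [:: a0; a1; a2; a3; a4; a5; a6] ->
  nbrs2 a0 a6 a1 -> nbrs2 a1 a0 a2 -> nbrs2 a2 a1 a3 -> nbrs2 a3 a2 a4 ->
  nbrs2 a4 a3 a5 -> nbrs2 a5 a4 a6 -> nbrs2 a6 a5 a0 -> False.
Proof.
set L := [:: a0; a1; a2; a3; a4; a5; a6] => uL N0 N1 N2 N3 N4 N5 N6.
pose a i := nth a0 L i.
have aE i j : (i < 7)%N -> (j < 7)%N -> (a i == a j) = (i == j) by move=> *; apply: nth_uniq.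
have eE i j : (i < 7)%N -> (j < 7)%N -> e (a i) (a j) = adj7 i j.
  move=> lti ltj.
  have [i1 [i2 [lt1 lt2 Ni ->]]] : exists i1 i2, [/\ (i1 < 7)%N, (i2 < 7)%N,
      nbrs2 (a i) (a i1) (a i2) & adj7 i j = (j == i1) || (j == i2)].
    case: i lti => [|[|[|[|[|[|[|?]]]]]]] // _;
      [exists 6%N, 1%N|exists 0%N, 2%N|exists 1%N, 3%N|exists 2%N, 4%N|exists 3%N, 5%N|exists 4%N, 6%N|exists 5%N, 0%N];
      split=> //; by case: j ltj => [|[|[|[|[|[|[|?]]]]]]].
  by rewrite (nbrs2E Ni) !aE.
have allV x : x \in L.
  apply: (connected_closed (a := a0)); first by rewrite mem_head.
  move=> y z; rewrite !inE => /orP[|/orP[|/orP[|/or4P[]]]]/eqP->;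
   rewrite ?(nbrs2E N0) ?(nbrs2E N1) ?(nbrs2E N2) ?(nbrs2E N3) ?(nbrs2E N4) ?(nbrs2E N5) ?(nbrs2E N6);
   by case/orP=> ->; rewrite ?orbT.
pose ix x := index x L.
have ixlt x : (ix x < 7)%N by rewrite /ix -[7%N]/(size L) index_mem.
have aK x : a (ix x) = x by rewrite /a nth_index.
have ixa i : (i < 7)%N -> ix (a i) = i by move=> lti; rewrite /ix index_uniq.
pose c x y : K := (wind7 (ix x) (ix y))%:~R.
have iF : indep e (a 0 |: [set a 2; a 4]).
  apply: (indepU1 eirr e_sym); first by apply: (indep2 eirr e_sym); rewrite eE.
  by move=> y /set2P[]->; rewrite eE.
have cF : (2 < #|a 0%N |: [set a 2; a 4]|)%N by rewrite cardsU1 cards2 !inE !aE.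
have [|f fP] := cm_simply_connected (c := c) eirr e_sym CM iF cF.
  move=> i j k; rewrite -(aK i) -(aK j) -(aK k) !eE // => nij njk nik.
  rewrite /c !ixa // -rmorphB -rmorphD wind7_cocycle ?rmorph0 ?nij ?njk ?nik //.
have step i j : (i < 7)%N -> (j < 7)%N -> i != j -> ~~ adj7 i j ->
    (wind7 i j)%:~R = f (a j) - f (a i).
  move=> lti ltj nij nadj; rewrite -fP; first by rewrite /c !ixa.
    by rewrite aE.
  by rewrite eE //; apply/negbTE.
have s i j : (i < 7)%N -> (j < 7)%N -> i != j -> ~~ adj7 i j -> wind7 i j = 0 -> f (a j) = f (a i).
  by move=> lti ltj nij nadj w0; apply/eqP; rewrite -subr_eq0 -step // w0.
have := step 5 0 isT isT isT isT.
rewrite (s 3 5) // (s 1 3) // (s 6 1) // (s 4 6) // (s 2 4) // (s 0 2) //.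
by rewrite subrr => /eqP; rewrite oner_eq0.
Qed.

End ExcludedCycles.

(** * Powers of the cover ideal *)

Section CoverIdeal.
Variables (K : fieldType) (n : nat) (e : rel 'I_n).
Local Notation V := 'I_n.
Local Notation mis := (maxset (indep e)).
Local Notation J := (@cover_ideal K n e).
Local Open Scope ring_scope.

Lemma vertex_coverP (C : {set V}) : vertex_cover e C <-> indep e (~: C).
Proof.
split=> [cC|/indepP iC x y exy].
  apply/indepP => x y; rewrite !inE => xC yC; apply/negP => /cC[] H; first by rewrite H in xC.
  by rewrite H in yC.
have [|xC] := boolP (x \in C); first by left.
have [|yC] := boolP (y \in C); first by right.
by rewrite iC ?inE in exy.
Qed.

Lemma minimal_vertex_coverP (C : {set V}) : minimal_vertex_cover e C <-> mis (~: C).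
Proof.
split=> [[/vertex_coverP iC minC]|/maxsetP[iC maxC]].
  apply/maxsetP; split=> // B iB sB; apply/eqP; rewrite eqEsubset sB andbT.
  apply: contraT => nB; case: (minC (~: B)); last by apply/vertex_coverP; rewrite setCK.
  by rewrite -(setCK C) properC /proper sB.
split=> [|D]; first exact/vertex_coverP.
rewrite -properC => pD /vertex_coverP iD.
by move: (pD); rewrite (maxC _ iD (proper_sub pD)) properxx.
Qed.

Definition cover_mon (F : {set V}) : 'X_{1..n} := [multinom (i \notin F : nat) | i < n].

Lemma prod_coverX (C : {set V}) : \prod_(i in C) 'X_i = 'X_[cover_mon (~: C)] :> {mpoly K[n]}.
Proof.
rewrite mprodXE; congr 'X_[_]; apply/mnmP => i; rewrite mnm_sumE mnmE inE negbK big_mkcond /=.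
rewrite (bigD1 i) //= mnm1E eqxx big1 ?addn0; first by case: (i \in C).
by move=> j ji; case: (j \in C); rewrite // mnm1E (negPf ji).
Qed.

Definition family_mon k (G : 'I_k -> {set V}) : 'X_{1..n} := (\sum_(i < k) cover_mon (G i))%MM.

(** Each member contains [x] or has it in its complement, so exponents and multiplicities determine
    each other. *)
Lemma family_monE k (G : 'I_k -> {set V}) x : (family_mon G x + mult G x)%N = k.
Proof.
rewrite mnm_sumE -big_split /= -[RHS]card_ord -sum1_card; apply: eq_bigr => i _.
by rewrite mnmE; case: (x \in G i).
Qed.

Lemma family_mon_mem k (G : 'I_k -> {set V}) : (forall i, mis (G i)) ->
  ideal_pow J k 'X_[family_mon G].
Proof.
elim: k G => [//|k IHk] G mG; rewrite /ideal_pow iterS.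
exists [:: ('X_[cover_mon (G ord0)], 'X_[family_mon (fun i => G (lift ord0 i))])].
split; last by rewrite big_seq1 /= -mpolyXD /family_mon big_ord_recl.
move=> p; rewrite inE => /eqP->; split; last by apply: IHk => i; apply: mG.
apply: ideal_gen_sub; exists (~: G ord0); rewrite prod_coverX setCK; split=> //.
by apply/minimal_vertex_coverP; rewrite setCK.
Qed.

Lemma cover_ideal_supp f m : J f -> m \in msupp f -> exists2 F, mis F & (cover_mon F <= m)%MM.
Proof.
case=> cs [csP ->] /msupp_sum_le /flattenP[ms /mapP[p]].
rewrite mem_filter /= => pcs ->.
have [C [/minimal_vertex_coverP mC ->]] := csP p pcs.
rewrite prod_coverX (perm_mem (msuppMX _ _)) => /mapP[m' _ ->].
by exists (~: C) => //; apply: lem_addr.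
Qed.

(** A monomial of a product is a product of monomials of the factors; by induction it is a multiple
    of a product of [k] generators. *)
Lemma ideal_pow_supp k f m : ideal_pow J k f -> m \in msupp f ->
  exists2 G : 'I_k -> {set V}, (forall i, mis (G i)) & (family_mon G <= m)%MM.
Proof.
elim: k f m => [|k IHk] f m.
  move=> _ _; exists (fun=> set0) => [[]//|]; apply/mnm_lepP => i.
  by rewrite mnm_sumE big_ord0.
rewrite /ideal_pow iterS => -[cs [csP ->]] /msupp_sum_le /flattenP[ms /mapP[p]].
rewrite mem_filter /= => pcs -> /msuppM_le /allpairsP[[m1 m2] /= [m1p m2p ->]].
have [J1 J2] := csP p pcs.
have [F mF leF] := cover_ideal_supp J1 m1p; have [G mG leG] := IHk _ _ J2 m2p.
exists (fun i => if unlift ord0 i is Some j then G j else F).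
  by move=> i; case: unliftP => [j _|_].
rewrite /family_mon big_ord_recl unlift_none.
under eq_bigr => i _ do rewrite liftK.
by apply/mnm_lepP => x; rewrite !mnmDE leq_add //; [apply: (mnm_lepP leF)|apply: (mnm_lepP leG)].
Qed.

Lemma min_mon_gen_family k u : min_mon_gen (ideal_pow J k) u ->
  exists2 G : 'I_k -> {set V}, (forall i, mis (G i)) & u = family_mon G.
Proof.
case=> Ju minu; have [|G mG leG] := ideal_pow_supp Ju (m := u); first by rewrite msuppX mem_head.
by exists G => //; rewrite (minu _ (family_mon_mem mG) leG).
Qed.

End CoverIdeal.

(** * Sorting the vertices by level and the conclusion *)

Lemma perm_of_level n (l : 'I_n -> nat) :
  exists s : 'S_n, forall i j : 'I_n, (l (s i) < l (s j))%N -> (i < j)%N.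
Proof.
pose r := relpre l leq; pose L := sort r (enum 'I_n).
have rtot : total r by move=> x y; apply: leq_total.
have rtr : transitive r by move=> x y z; apply: leq_trans.
have sL : size L = n by rewrite size_sort size_enum_ord.
have uL : uniq L by rewrite sort_uniq enum_uniq.
pose f (i : 'I_n) : 'I_n := nth i L i.
have fE x0 i : f i = nth x0 L i by apply: set_nth_default; rewrite sL.
have finj : injective f.
  move=> i j; rewrite (fE i j) /f => /eqP; rewrite nth_uniq ?sL // => /eqP/ord_inj.
  by [].
exists (perm finj) => i j; rewrite !permE; apply: contraLR; rewrite -!leqNgt => le_ji.
rewrite (fE i j) /f; apply: (sorted_leq_nth rtr) => //; rewrite ?inE ?sL //.
  by move=> x; apply: leqnn.
exact: sort_sorted.
Qed.

Theorem theorem1 (K : fieldType) (n : nat) (e : rel 'I_n) :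
  simple_graph e -> cactus e -> cohen_macaulay (@edge_ideal K n e) ->
  forall k : nat, (1 <= k)%N -> weakly_polymatroidal (ideal_pow (@cover_ideal K n e) k).
Proof.
move=> [eirr e_sym] [e_conn cactusE] CM k _.
have wc F F' : maxset (indep e) F -> indep e F' -> (#|F'| <= #|F|)%N.
  exact: (cm_unmixed eirr e_sym CM).
have noC4 := cm_not_C4 eirr e_sym e_conn CM.
have noC7 := cm_not_C7 eirr e_sym e_conn CM.
have [s sP] := perm_of_level (level e).
(* The generators have a common degree because all maximal independent sets have the same size. *)
exists s; split=> [u v /min_mon_gen_family[G mG ->] /min_mon_gen_family[H mH ->]|].
  rewrite !mdeg_sum; apply: eq_bigr => i _.
  have mdegE F : mdeg (cover_mon F) = #|~: F|.
    rewrite mdegE -sum1_card big_mkcond [RHS]big_mkcond /=; apply: eq_bigr => x _.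
    by rewrite mnmE inE; case: (x \in F).
  rewrite !mdegE; have := cardsC (G i); rewrite -(cardsC (H i)).
  have -> : #|G i| = #|H i|.
    have [iG _] := maxsetP (mG i); have [iH _] := maxsetP (mH i).
    by apply/eqP; rewrite eqn_leq !wc.
  by move/addnI.
move=> u v t /min_mon_gen_family[G mG ->] /min_mon_gen_family[H mH ->] eqr ltt.
pose rk (x : 'I_n) : nat := (s^-1)%g x.
have rk_inj : injective rk by move=> x y /ord_inj; apply: perm_inj.
have rk_level x y : (level e x < level e y)%N -> (rk x < rk y)%N.
  by move=> lxy; apply: sP; rewrite !permKV.
have rks r : rk (s r) = r by rewrite /rk permK.
have [y [ty [H' [mH' HE]]]] : exists y, (rk (s t) < rk y)%N /\ exchange e H (s t) y.
  apply: (exchange_exists eirr e_sym cactusE wc e_conn noC4 noC7 rk_inj rk_level mG mH).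
    move=> x; rewrite rks => ltx.
    have := eqr ((s^-1)%g x) ltx; rewrite permKV.
    by have := family_monE G x; have := family_monE H x; clear; lia.
  by have := family_monE G (s t); have := family_monE H (s t); move: ltt; clear; lia.
(* The variable divided out is [x_y], whose position in the ordering is the preimage of [y] under
   [s]. *)
exists ((s^-1)%g y); split; first by rewrite -{1}(rks t).
exists (family_mon H'); split; last exact: family_mon_mem.
apply/mnmP => x; rewrite permKV !mnmDE !mnm1E [y == x]eq_sym [s t == x]eq_sym.
have := HE x; have := family_monE H x; have := family_monE H' x.
by case: (x == y); case: (x == s t); clear; lia.
Qed.
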